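(* In the round-synchronous model, the Miller–Reif (MR) tree contraction algorithm, on a (bounded-degree) forest with $n$ vertices, does $O(n)$ work in expectation and has $O(\log n)$ rounds and span w.h.p. Furthermore, given a forest $T$ with $n$ vertices, and a forest $T'$ obtained from $T$ by $k$ modifications (insertions or deletions) to the edge list of $T$, the computation distance of the round-synchronous MR algorithm on the two inputs is $O(k\log(1+n/k))$ in expectation.
   Context: Round-synchronous model. A round-synchronous algorithm is given by a deterministic procedure ComputeRound$(i,u)$ and is run from an input configuration (initial contents of shared memory, and a set of initial processes). In each round $i=0,1,2,\dots$ every active process $u$ executes, in parallel, ComputeRound$(i,u)$, which reads and writes shared memory; writes become visible only at the end of the round, and each location is written only once. A process may retire at the end of a round; the algorithm terminates when all have retired. Work is the sum of the costs of all executed round computations; span is the sum over rounds of the maximum cost of a round computation. Given two input configurations, a pair $(i,u)$ is an affected computation if process $u$ runs in round $i$ on one configuration but not the other, or runs in round $i$ on both but reads a shared location whose value differs between the two. The computation distance is the sum of the work of all affected computations with respect to both configurations. MR algorithm. The input is an undirected forest whose vertices are ordered by their IDs and have at most $t$ neighbors, $t$ a fixed constant. There is one process per vertex. Coin flips are given by a function $\mathrm{Heads}(i,v)$ of round and vertex, whose values are independent unbiased coin flips and are the same for the executions on $T$ and $T'$. Shared memory holds, for each round $i$ and each vertex $u$ alive at round $i$, an array $A[i][u]$ of $t$ slots, each slot being empty ($\perp$) or a pair $(v,p)$ where $v$ is a neighbor of $u$ and $p$ is the slot of $u$ in $v$'s array; a Boolean $\mathrm{leaf}[i][u]$ that is true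 iff $u$ has exactly one neighbor at round $i$; and $D[u]$, the round in which $u$ is deleted. The arrays $A[0]$ and $\mathrm{leaf}[0]$ encode the input forest; edges common to $T$ and $T'$ occupy the same slots in both. ComputeRound$(i,u)$ reads $A[i][u]$ and $\mathrm{leaf}[i][u]$ and acts as follows. - If all slots are empty: finalize (write $D[u]=i$, retire). - If $\mathrm{leaf}[i][u]$ holds, with unique neighbor entry $(v,p)$: read $\mathrm{leaf}[i][v]$; if it is false or $u<v$, rake: write $\perp$ to $A[i+1][v][p]$, write $D[u]=i$, retire. Otherwise stay alive. - If $u$ has exactly two neighbor entries $(v,p),(v',p')$: read $\mathrm{leaf}[i][v],\mathrm{leaf}[i][v']$; if both are false and $\mathrm{Heads}(i,u)\wedge\neg\mathrm{Heads}(i,v)\wedge\neg\mathrm{Heads}(i,v')$, compress: write $(v',p')$ to $A[i+1][v][p]$, write $(v,p)$ to $A[i+1][v'][p']$, write $D[u]=i$, retire. Otherwise stay alive. - If $u$ has three or more neighbors: stay alive. Staying alive means: for each slot $j$ of $A[i][u]$, if it holds $(v_j,p_j)$ then write $(u,j)$ to $A[i+1][v_j][p_j]$ and read $\mathrm{leaf}[i][v_j]$, and if it is empty write $\perp$ to $A[i+1][u][j]$; then write to $\mathrm{leaf}[i+1][u]$ whether exactly one neighbor $v_j$ has $\mathrm{leaf}[i][v_j]$ false. Each round computation has cost $O(1)$. ''W.h.p.'' means: for every $c>0$, with suitable constants in the $O(\cdot)$, with probability at least $1-n^{-c}$. Expectations are over the coin flips. *)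

(* Defs.v *)
From HB Require Import structures.
From mathcomp Require Import all_boot all_order all_algebra.
From mathcomp Require Import all_classical all_reals all_analysis.

Set Implicit Arguments.
Unset Strict Implicit.
Unset Printing Implicit Defensive.

Import Order.TTheory GRing.Theory Num.Theory.

(* The code of one round computation: it reads and writes shared memory and
   returns a value of type [X]. Reading a location that was never initialised
   or written yields [None]. *)
Inductive prog (Loc Val X : Type) : Type :=
| Ret of X
| Read of Loc & (option Val -> prog Loc Val X)
| Write of Loc & Val & prog Loc Val X.

Arguments Ret {Loc Val X} _.
Arguments Read {Loc Val X} _ _.
Arguments Write {Loc Val X} _ _ _.

Fixpoint bind (Loc Val X Y : Type) (p : prog Loc Val X)
    (f : X -> prog Loc Val Y) : prog Loc Val Y :=
  match p with
  | Ret x => f x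
  | Read l k => Read l (fun v => bind (k v) f)
  | Write l v p' => Write l v (bind p' f)
  end.

Fixpoint mapM (Loc Val X Y : Type) (f : X -> prog Loc Val Y) (s : seq X) :
    prog Loc Val (seq Y) :=
  if s is x :: s' then
    bind (f x) (fun y => bind (mapM f s') (fun ys => Ret (y :: ys)))
  else Ret [::].

Declare Scope prog_scope.
Delimit Scope prog_scope with prog.
Notation "'let!' x := p 'in' q" := (bind p (fun x => q))
  (at level 200, x name, p at level 100, q at level 200) : prog_scope.

Section Model.
Variables (Proc : finType) (Loc Val : eqType).

Definition memory := Loc -> option Val.

(* [alg i u] is ComputeRound(i, u); the Boolean result says whether [u]
   retires at the end of round [i]. *)
Definition algorithm := nat -> Proc -> prog Loc Val bool.

Record config := Config { contents : memory; processes : {set Proc} }.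

(* A round computation only sees the memory [m] of the beginning of the round:
   its own writes do not affect its reads. *)
Fixpoint result (X : Type) (m : memory) (p : prog Loc Val X) : X :=
  match p with
  | Ret x => x
  | Read l k => result m (k (m l))
  | Write _ _ p' => result m p'
  end.

Fixpoint reads (X : Type) (m : memory) (p : prog Loc Val X) : seq Loc :=
  match p with
  | Ret _ => [::]
  | Read l k => l :: reads m (k (m l))
  | Write _ _ p' => reads m p'
  end.

Fixpoint writes (X : Type) (m : memory) (p : prog Loc Val X) :
    seq (Loc * Val) :=
  match p with
  | Ret _ => [::]
  | Read l k => writes m (k (m l))
  | Write l v p' => (l, v) :: writes m p'
  end.

(* One unit for the invocation, and one for every shared-memory access. *)
Definition cost (X : Type) (m : memory) (p : prog Loc Val X) : nat :=
  (size (reads m p) + size (writes m p)).+1.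

Definition update (m : memory) (lv : Loc * Val) : memory :=
  fun l => if l == lv.1 then Some lv.2 else m l.

(* In a round-synchronous algorithm each location is written only once, so the
   order in which the writes of a round are committed is irrelevant. *)
Definition step (alg : algorithm) (i : nat) (c : config) : config :=
  {| contents := foldl update (contents c)
       (flatten [seq writes (contents c) (alg i u) | u <- enum (processes c)]);
     processes := [set u in processes c | ~~ result (contents c) (alg i u)]%SET
  |}.

(* The shared memory at the beginning of round [i], together with the processes
   that run in round [i]. *)
Fixpoint state (alg : algorithm) (c : config) (i : nat) : config :=
  if i is j.+1 then step alg j (state alg c j) else c.

Definition runs (alg : algorithm) (c : config) (i : nat) (u : Proc) : bool :=
  u \in processes (state alg c i).

Definition comp_reads (alg : algorithm) (c : config) (i : nat) (u : Proc) :=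
  reads (contents (state alg c i)) (alg i u).

Definition comp_cost (alg : algorithm) (c : config) (i : nat) (u : Proc) :=
  cost (contents (state alg c i)) (alg i u).

Definition terminated (alg : algorithm) (c : config) (i : nat) : bool :=
  processes (state alg c i) == finset.set0.

Definition affected (alg : algorithm) (c c' : config) (i : nat) (u : Proc) :
    bool :=
  (runs alg c i u != runs alg c' i u)
  || [&& runs alg c i u, runs alg c' i u
       & has (fun l => contents (state alg c i) l != contents (state alg c' i) l)
             (comp_reads alg c i u ++ comp_reads alg c' i u)].

(* The costs below are extended reals, so that they are also meaningful (and
   possibly infinite) for executions that do not terminate. *)
Variable R : realType.

Definition num_rounds (alg : algorithm) (c : config) : \bar R :=
  ereal_inf [set (i%:R)%:E | i in [set i | terminated alg c i]]%classic.

Definition total_work (alg : algorithm) (c : config) : \bar R :=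
  (\sum_(0 <= i <oo) (\sum_(u | runs alg c i u) comp_cost alg c i u)%N%:R%:E)%E.

Definition total_span (alg : algorithm) (c : config) : \bar R :=
  (\sum_(0 <= i <oo)
     (\max_(u | runs alg c i u) comp_cost alg c i u)%N%:R%:E)%E.

Definition computation_distance (alg : algorithm) (c c' : config) : \bar R :=
  (\sum_(0 <= i <oo)
     (\sum_(u | affected alg c c' i u)
        ((if runs alg c i u then comp_cost alg c i u else 0)
         + (if runs alg c' i u then comp_cost alg c' i u else 0)))%N%:R%:E)%E.

End Model.

Arguments num_rounds {Proc Loc Val} R alg c.
Arguments total_work {Proc Loc Val} R alg c.
Arguments total_span {Proc Loc Val} R alg c.
Arguments computation_distance {Proc Loc Val} R alg c c'.

Section Forests.
Variable V : finType.

(* A graph on [V] is given by the set [E] of its edges, which are two-element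
   sets of vertices. *)
Definition adjacent (E : {set {set V}}) : rel V :=
  fun u v => [set u; v]%SET \in E.

Definition degree (E : {set {set V}}) (u : V) : nat :=
  #|[set v | adjacent E u v]%SET|.

Definition is_forest (E : {set {set V}}) : Prop :=
  (forall e, e \in E -> #|e| = 2) /\
  (forall c : seq V, 2 < size c -> ~~ ucycleb (adjacent E) c).

Definition bounded_forest (t : nat) (E : {set {set V}}) : Prop :=
  is_forest E /\ forall u, degree E u <= t.

Inductive modification := Insert of {set V} | Delete of {set V}.

Definition modify (E : {set {set V}}) (m : modification) : {set {set V}} :=
  match m with
  | Insert e => (e |: E)%SET
  | Delete e => (E :\ e)%SET
  end.

(* The intermediate edge sets need not be forests. *)
Definition modified (k : nat) (E E' : {set {set V}}) : Prop :=
  exists ms : seq modification, size ms = k /\ foldl modify E ms = E'.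

End Forests.

(* [None] is the empty slot; [Some (v, p)] is a neighbor [v] together with the
   slot that the owner of the array has in the array of [v]. *)
Definition slot (t : nat) (V : Type) : Type := option (V * 'I_t).

Inductive loc (t : nat) (V : Type) : Type :=
| LocA of nat & V & 'I_t
| LocLeaf of nat & V
| LocD of V.

Inductive val (t : nat) (V : Type) : Type :=
| ValSlot of slot t V
| ValLeaf of bool
| ValRound of nat.

Arguments LocA {t V} _ _ _.
Arguments LocLeaf {t V} _ _.
Arguments LocD {t V} _.
Arguments ValSlot {t V} _.
Arguments ValLeaf {t V} _.
Arguments ValRound {t V} _.

Section Equality.
Variables (t : nat) (V : eqType).

Definition loc_encode (l : loc t V) : (nat * V * 'I_t) + ((nat * V) + V) :=
  match l with
  | LocA i u j => inl (i, u, j)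
  | LocLeaf i u => inr (inl (i, u))
  | LocD u => inr (inr u)
  end.

Definition loc_decode (x : (nat * V * 'I_t) + ((nat * V) + V)) : loc t V :=
  match x with
  | inl (i, u, j) => LocA i u j
  | inr (inl (i, u)) => LocLeaf i u
  | inr (inr u) => LocD u
  end.

Lemma loc_encodeK : cancel loc_encode loc_decode.
Proof. by case. Qed.

HB.instance Definition _ := Equality.copy (loc t V) (can_type loc_encodeK).

Definition val_encode (x : val t V) : slot t V + (bool + nat) :=
  match x with
  | ValSlot s => inl s
  | ValLeaf b => inr (inl b)
  | ValRound i => inr (inr i)
  end.

Definition val_decode (x : slot t V + (bool + nat)) : val t V :=
  match x with
  | inl s => ValSlot s
  | inr (inl b) => ValLeaf b
  | inr (inr i) => ValRound i
  end.

Lemma val_encodeK : cancel val_encode val_decode.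
Proof. by case. Qed.

HB.instance Definition _ := Equality.copy (val t V) (can_type val_encodeK).

End Equality.

Section MillerReif.
Variables (t : nat) (disp : Order.disp_t) (V : finOrderType disp).

Local Notation prog := (prog (loc t V) (val t V)).
Local Open Scope prog_scope.

Definition read_slot (i : nat) (u : V) (j : 'I_t) : prog (slot t V) :=
  Read (LocA i u j) (fun x => Ret (if x is Some (ValSlot s) then s else None)).

Definition read_leaf (i : nat) (u : V) : prog bool :=
  Read (LocLeaf i u)
    (fun x => Ret (if x is Some (ValLeaf b) then b else false)).

Definition delete (i : nat) (u : V) : prog bool :=
  Write (LocD u) (ValRound i) (Ret true).

Definition stay_slot (i : nat) (u : V) (js : 'I_t * slot t V) : prog bool :=
  if js.2 is Some (v, p) then
    Write (LocA i.+1 v p) (ValSlot (Some (u, js.1)))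
      (let! b := read_leaf i v in Ret (~~ b))
  else Write (LocA i.+1 u js.1) (ValSlot None) (Ret false).

Definition stay (i : nat) (u : V) (a : seq (slot t V)) : prog bool :=
  let! nonleaf := mapM (stay_slot i u) (zip (enum 'I_t) a) in
  Write (LocLeaf i.+1 u) (ValLeaf (count id nonleaf == 1)) (Ret false).

Definition MR (heads : nat -> V -> bool) : algorithm V (loc t V) (val t V) :=
  fun i u =>
  let! a := mapM (read_slot i u) (enum 'I_t) in
  let! leaf_u := read_leaf i u in
  match pmap id a with
  | [::] => delete i u
  | [:: (v, p)] =>
      if leaf_u then
        let! leaf_v := read_leaf i v in
        if ~~ leaf_v || (u < v)%O then
          Write (LocA i.+1 v p) (ValSlot None) (delete i u)
        else stay i u a
      else stay i u a
  | [:: (v, p); (v', p')] =>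
      let! leaf_v := read_leaf i v in
      let! leaf_v' := read_leaf i v' in
      if [&& ~~ leaf_v, ~~ leaf_v', heads i u, ~~ heads i v & ~~ heads i v']
      then Write (LocA i.+1 v p) (ValSlot (Some (v', p')))
             (Write (LocA i.+1 v' p') (ValSlot (Some (v, p))) (delete i u))
      else stay i u a
  | _ => stay i u a
  end.

(* [A] lays out the edges of [E] in adjacency arrays of [t] slots. *)
Definition encodes (E : {set {set V}}) (A : V -> 'I_t -> slot t V) : Prop :=
  (forall u j v p, A u j = Some (v, p) ->
     adjacent E u v /\ A v p = Some (u, j)) /\
  (forall u v, adjacent E u v -> exists! j, exists p, A u j = Some (v, p)).

Definition same_slots (E E' : {set {set V}}) (A A' : V -> 'I_t -> slot t V) :
    Prop :=
  forall u v j p, adjacent E u v -> adjacent E' u v ->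
    (A u j = Some (v, p) <-> A' u j = Some (v, p)).

Definition MR_input (E : {set {set V}}) (A : V -> 'I_t -> slot t V) :
    config V (loc t V) (val t V) :=
  {| contents := fun l =>
       match l with
       | LocA 0 u j => Some (ValSlot (A u j))
       | LocLeaf 0 u => Some (ValLeaf (degree E u == 1))
       | _ => None
       end;
     processes := [set: V]%SET |}.

End MillerReif.

Definition mutually_independent (d d' : measure_display)
    (Omega : measurableType d) (R : realType) (P : probability Omega R)
    (I : eqType) (T : measurableType d') (X : I -> {RV P >-> T}) : Prop :=
  forall (s : seq I) (B : I -> set T), uniq s -> (forall x, measurable (B x)) ->
    P (\bigcap_(x in [set` s]) (X x @^-1` B x))%classic
    = (\prod_(x <- s) P (X x @^-1` B x)%classic)%E.

Definition fair_coins (d : measure_display) (Omega : measurableType d)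
    (R : realType) (P : probability Omega R) (I : eqType)
    (X : I -> {RV P >-> bool}) : Prop :=
  mutually_independent X /\
  forall x, P [set w | X x w = true]%classic = (2^-1)%:E.

(* Main.v *)
(* MR contraction of a forest deletes each isolated vertex, at least half of
   the leaves, and each vertex with exactly two neighbors, both nonleaf, with
   probability 1/8.  As the edges of a forest are fewer than its vertices, the
   branching vertices are at most as many as the leaves, so that a round deletes
   a constant fraction of the vertices in expectation.  This gives the linear
   work and, by Markov's inequality, the logarithmic number of rounds.

   For the computation distance, we mark a superset of the affected vertices:
   initially the endpoints of the modified edges and their neighbors, and then
   each vertex next to a marked vertex that compresses or becomes a leaf in one
   of the two executions.  A mark is traced back to an initial one, which
   divides the marked vertices into O(k) classes.  Each class stays connected in
   both forests and never has more than two frontier vertices (marked vertices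
   with an unmarked neighbor): a frontier vertex can spread its mark only once
   it has at most two neighbors, one of which is marked when the class has
   another frontier vertex.  Hence O(k) marks are added per round, while away
   from the frontier the marked part of each forest contracts at a constant
   rate, so the expected number of marked vertices alive is O(k) in each round.
   Summing min(O(k), O(n (7/8)^i)) over the rounds i gives the bound. *)
Require Import Defs.
From mathcomp Require Import all_boot all_order all_algebra.
From mathcomp Require Import all_classical all_reals all_analysis.
(* [finset] comes again so that its lemma names shadow those of [classical_sets]. *)
From mathcomp Require Import measurable_realfun finset.
From mathcomp Require Import zify lra ring.

Set Implicit Arguments.
Unset Strict Implicit.
Unset Printing Implicit Defensive.

Import Order.TTheory GRing.Theory Num.Theory.

(** * Contraction of a forest *)

Section Contraction.
Variables (t : nat) (disp : Order.disp_t) (V : finOrderType disp).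
Local Open Scope set_scope.
Local Notation slots := (V -> 'I_t -> slot t V).
Implicit Types (a : slots) (u v w : V) (j p q : 'I_t) (hd : V -> bool).

(** Acyclicity is handled as the absence of a nonempty vertex set of minimum degree two. In this
    form it survives contraction, bounds the number of edges inside any vertex set, and excludes the
    short cycles that contraction would turn into parallel edges. Marks need not spread at every
    difference between the executions. An unmarked vertex sees a neighbor only through an edge and a
    leaf bit. While a marked neighbor is a nonleaf in both executions, the bit is the same in both
    and the neighbor cannot rake. Only its compression changes slots of the unmarked vertex, and
    only its becoming a leaf can spoil the bit; hence these two rules of spreading. Probability
    enters late. A quantity decided by finitely many rounds is averaged over a finite set of coin
    arrays, where all bounds are inequalities between natural numbers. The arrays of a round depend
    on earlier coins only, so flipping the three coins of a possible compression one at a time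
    yields the factor 1/8. *)

Definition nbrs a u : seq (V * 'I_t) := pmap id [seq a u j | j <- enum 'I_t].

Definition adj a : rel V := fun u v => v \in unzip1 (nbrs a u).

Definition leaf a u := size (nbrs a u) == 1.

Definition rakes a u :=
  if nbrs a u is [:: (v, _)] then ~~ leaf a v || (u < v)%O else false.

Definition compresses hd a u :=
  if nbrs a u is [:: (v, _); (v', _)] then
    [&& ~~ leaf a v, ~~ leaf a v', hd u, ~~ hd v & ~~ hd v']
  else false.

Definition dies hd a u := [|| nilp (nbrs a u), rakes a u | compresses hd a u].

Definition other a v (x : V * 'I_t) : slot t V :=
  if nbrs a v is [:: y; z] then Some (if x == y then z else y) else None.

(** The slots of a dying vertex are emptied, whatever its neighbors still write into them, so that
    every edge of the result joins survivors. A bypass keeps the slot indices at both far ends,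
    which preserves the symmetry of the arrays. *)
Definition contract hd a : slots := fun u j =>
  if dies hd a u then None else
  if a u j is Some (v, p) then
    if rakes a v then None
    else if compresses hd a v then other a v (u, j) else Some (v, p)
  else None.

(* [wf_core] is acyclicity: a forest has no subgraph of minimum degree two. *)
Record wf a : Prop := Wf {
  wf_sym : forall u j v p, a u j = Some (v, p) -> a v p = Some (u, j);
  wf_uniq : forall u j j' v p p',
    a u j = Some (v, p) -> a u j' = Some (v, p') -> j = j';
  wf_irr : forall u j p, a u j <> Some (u, p);
  wf_core : forall X : {set V},
    (forall x, x \in X -> exists y z,
       [/\ y \in X, z \in X, y != z, adj a x y & adj a x z]) -> X = set0 }.

Lemma mem_nbrs a u x : reflect (exists j, a u j = Some x) (x \in nbrs a u).
Proof.
rewrite /nbrs mem_pmap map_id.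
apply: (iffP mapP) => [[j _ ->]|[j <-]]; first by exists j.
by exists j; rewrite ?mem_enum.
Qed.

Lemma adjP a u v : reflect (exists j p, a u j = Some (v, p)) (adj a u v).
Proof.
apply: (iffP mapP) => [[[v' p] /mem_nbrs[j aj] /= ->]|[j [p aj]]].
  by exists j, p.
by exists (v, p) => //; apply/mem_nbrs; exists j.
Qed.

Lemma adj_slot a u j v p : a u j = Some (v, p) -> adj a u v.
Proof. by move=> h; apply/adjP; exists j, p. Qed.

Lemma adj_nbrs1 a u x : nbrs a u = [:: x] -> forall w, adj a u w = (w == x.1).
Proof. by rewrite /adj => -> w; rewrite inE. Qed.

Lemma adj_nbrs2 a u x y : nbrs a u = [:: x; y] ->
  forall w, adj a u w = (w == x.1) || (w == y.1).
Proof. by rewrite /adj => -> w; rewrite !inE. Qed.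

Lemma adj_sym a : wf a -> symmetric (adj a).
Proof.
move=> wa u v; apply/idP/idP => /adjP[j [p]] /(wf_sym wa); exact: adj_slot.
Qed.

Lemma adj_irr a u : wf a -> adj a u u = false.
Proof. by move=> wa; apply/adjP => -[j [p]]; exact: wf_irr. Qed.

Lemma nbrs_uniq a u : wf a -> uniq (unzip1 (nbrs a u)).
Proof.
move=> wa; rewrite /nbrs.
elim: (enum 'I_t) (enum_uniq 'I_t) => //= j s IHs /andP[js us].
case aj: (a u j) => [[v p]|] /=; last exact: IHs.
rewrite IHs // andbT; apply/mapP => -[[v' p'] /= vin vv']; subst v'.
move: vin; rewrite mem_pmap map_id => /mapP[j' j's /esym aj'].
by rewrite (wf_uniq wa aj aj') j's in js.
Qed.

Lemma size_nbrs a u : wf a -> size (nbrs a u) = #|[set v | adj a u v]|.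
Proof.
move=> wa; rewrite -(size_map fst) -/unzip1 cardsE.
by rewrite -(card_uniqP (nbrs_uniq u wa)).
Qed.

Lemma leafP a u : leaf a u -> exists2 v, adj a u v & forall w, adj a u w -> w = v.
Proof.
rewrite /leaf; case eq_n: (nbrs a u) => [|x []] //= _; exists x.1.
  by rewrite (adj_nbrs1 eq_n).
by move=> w; rewrite (adj_nbrs1 eq_n) => /eqP.
Qed.

Lemma leaf_nbr a u v w : leaf a u -> adj a u v -> adj a u w -> v = w.
Proof. by case/leafP=> x _ xw /xw -> /xw ->. Qed.

Lemma leafPn a u v : ~~ leaf a u -> adj a u v -> wf a ->
  exists2 w, adj a u w & w != v.
Proof.
rewrite /leaf; case eq_n: (nbrs a u) => [|x [|y s]] //= _.
  by rewrite /adj eq_n.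
move=> uv wa; have := nbrs_uniq u wa; rewrite eq_n /= inE negb_or.
case/andP=> /andP[xy _] _.
case: (eqVneq x.1 v) => [xv|xv]; [exists y.1|exists x.1] => //.
- by rewrite /adj eq_n !inE eqxx orbT.
- by rewrite -xv eq_sym.
- by rewrite /adj eq_n !inE eqxx.
Qed.

Lemma rakes_leaf a u : rakes a u -> leaf a u.
Proof. by rewrite /rakes /leaf; case: (nbrs a u) => [|[v p] []]. Qed.

Lemma rakesE a u v : leaf a u -> adj a u v ->
  rakes a u = ~~ leaf a v || (u < v)%O.
Proof.
rewrite /rakes {1}/leaf /adj; case: (nbrs a u) => [|[x p] []] //= _.
by rewrite inE => /eqP ->.
Qed.

Lemma compressesP hd a u : wf a -> compresses hd a u ->
  exists v w, [/\ v != w, adj a u v, adj a u w,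
    forall x, adj a u x -> x = v \/ x = w &
    [&& ~~ leaf a v, ~~ leaf a w, hd u, ~~ hd v & ~~ hd w]].
Proof.
move=> wa; rewrite /compresses.
case eq_n: (nbrs a u) => [|[v p] [|[w q] []]] //= c.
have := nbrs_uniq u wa; rewrite eq_n /= inE andbT => vw.
exists v, w; split=> //; rewrite ?(adj_nbrs2 eq_n) /= ?eqxx ?orbT //.
by move=> x; rewrite (adj_nbrs2 eq_n) /= => /orP[]/eqP; [left|right].
Qed.


Lemma nbrs_nil a u : nilp (nbrs a u) -> forall v, adj a u v = false.
Proof. by move=> /nilP n0 v; rewrite /adj n0. Qed.

(** Of two adjacent leaves only the smaller rakes, and a compressing vertex has no leaf neighbor and
    shows heads where its neighbors show tails. Hence a round never bypasses two consecutive
    vertices. *)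
Lemma dies_nbr hd a u v : wf a -> adj a u v -> dies hd a u -> ~~ dies hd a v.
Proof.
move=> wa uv; have vu : adj a v u by rewrite adj_sym.
have nv0 : ~~ nilp (nbrs a v).
  by apply/negP => /nbrs_nil/(_ u); rewrite vu.
rewrite /dies negb_or nv0 negb_or /=.
case/or3P => [/nbrs_nil/(_ v)|ru|/(compressesP wa)[x [y [_ _ _ xy]]]].
- by rewrite uv.
- have lu := rakes_leaf ru; rewrite (rakesE lu uv) in ru.
  apply/andP; split; last first.
    apply/negP => /(compressesP wa)[x [y [_ _ _ xy /and5P[]]]].
    by case: (xy _ vu) => <-; rewrite lu.
  case lv: (leaf a v) ru => /= uv'; last by apply/negP => /rakes_leaf; rewrite lv.
  by rewrite (rakesE lv vu) lu /= -leNgt ltW.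
case/and5P => lx ly hu hx hy.
have [lv hv]: ~~ leaf a v /\ ~~ hd v by case: (xy _ uv) => ->.
apply/andP; split; first by apply: contra lv; exact: rakes_leaf.
by apply/negP => /(compressesP wa)[x' [y' [_ _ _ _ /and5P[_ _]]]]; rewrite (negbTE hv).
Qed.

Lemma compresses_dies hd a u : compresses hd a u -> dies hd a u.
Proof. by rewrite /dies => ->; rewrite !orbT. Qed.

Lemma dies_adj hd a u v : adj a u v -> dies hd a u = rakes a u || compresses hd a u.
Proof. by rewrite /dies /adj; case: (nbrs a u). Qed.

Lemma compresses_size hd a u : compresses hd a u -> size (nbrs a u) = 2.
Proof. by rewrite /compresses; case: (nbrs a u) => [|[? ?] [|[? ?] []]]. Qed.

Lemma compresses_other hd a v p (x : V * 'I_t) : wf a -> compresses hd a v ->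
  a v p = Some x ->
  exists p' y, [/\ p != p', a v p' = Some y, other a v x = Some y &
    forall p'' z, a v p'' = Some z -> p'' = p \/ p'' = p'].
Proof.
move=> wa /compresses_size sz ax.
have [y [xy oy mem_v]] : exists y, [/\ y != x, other a v x = Some y &
    forall z, z \in nbrs a v = (z == x) || (z == y)].
  have := nbrs_uniq v wa; rewrite /other.
  have : x \in nbrs a v by apply/mem_nbrs; exists p.
  case: (nbrs a v) sz => [|z [|z' []]] //= _.
  rewrite !inE andbT => xz zz'.
  have {}zz' : z != z' by apply: contra zz' => /eqP ->.
  case: (eqVneq x z) xz => [->|_ /= /eqP ->].
    by exists z'; rewrite eq_sym; split=> // w; rewrite !inE.
  by exists z; split=> // w; rewrite !inE orbC.
have /mem_nbrs[p' ay] : y \in nbrs a v by rewrite mem_v eqxx orbT.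
exists p', y; split=> //.
  by apply: contra xy => /eqP pp'; move: ax; rewrite pp' ay => -[->].
move=> p'' z az; have : z \in nbrs a v by apply/mem_nbrs; exists p''.
rewrite mem_v => /orP[]/eqP zE; subst z; [left|right].
  by case: x ax az {xy oy mem_v} => ? ? ax az; apply: wf_uniq wa _ _ _ _ _ _ az ax.
by case: y ay az {xy oy mem_v} => ? ? ay az; apply: wf_uniq wa _ _ _ _ _ _ az ay.
Qed.

Lemma contract_direct hd a u j v p : wf a -> a u j = Some (v, p) ->
  ~~ dies hd a u -> ~~ dies hd a v -> contract hd a u j = Some (v, p).
Proof.
move=> wa auj /negbTE du; rewrite /contract du auj.
by rewrite (dies_adj _ (adj_slot (wf_sym wa auj))) negb_or => /andP[/negbTE-> /negbTE->].
Qed.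

Lemma contract_via hd a u j y p p' x : wf a -> a u j = Some (y, p) ->
  compresses hd a y -> a y p' = Some x -> p != p' ->
  contract hd a u j = Some x.
Proof.
move=> wa auj cy ayp pp'; have ayu := wf_sym wa auj.
have du := dies_nbr wa (adj_slot ayu) (compresses_dies cy).
rewrite /contract (negbTE du) auj cy.
rewrite (_ : rakes a y = false); last first.
  apply/negP => /rakes_leaf; rewrite /leaf (compresses_size cy) //.
have [p1 [x1 [_ ax1 -> p12]]] := compresses_other wa cy ayu.
by case: (p12 _ _ ayp) => pE; subst p'; [rewrite eqxx in pp' | rewrite -ax1].
Qed.

Lemma contractP hd a u j x : wf a -> contract hd a u j = Some x ->
  [/\ ~~ dies hd a u, ~~ dies hd a x.1 &
    a u j = Some x \/
    exists y p p', [/\ a u j = Some (y, p), compresses hd a y, p != p' &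
                        a y p' = Some x]].
Proof.
move=> wa; rewrite /contract; case du: (dies hd a u) => //.
case auj: (a u j) => [[y p]|] //; case ry: (rakes a y) => //.
have ayu := wf_sym wa auj.
case cy: (compresses hd a y); last first.
  by case=> <-; split; [|rewrite (dies_adj _ (adj_slot ayu)) /= ry cy|left].
have [p' [x' [pp' ax' ox' _]]] := compresses_other wa cy ayu.
rewrite ox' => -[E]; subst x'; split=> //; last by right; exists y, p, p'.
by case: x ax' {ox'} => x q /adj_slot yx; apply: dies_nbr yx (compresses_dies cy).
Qed.

Lemma adj_contract hd a u v : wf a -> adj (contract hd a) u v ->
  [/\ ~~ dies hd a u, ~~ dies hd a v &
    adj a u v \/ exists y, [/\ compresses hd a y, adj a u y, adj a y v & u != v]].
Proof.
move=> wa /adjP[j [q]] /(contractP wa)[du dv [/adj_slot uv|]].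
  by split=> //; left.
case=> [y [p [p' [auj cy pp' ayp]]]]; split=> //; right; exists y.
rewrite (adj_slot auj) (adj_slot ayp); split=> //.
apply: contra pp' => /eqP uv; subst v; have ayu := wf_sym wa auj.
by apply/eqP; apply: wf_uniq wa _ _ _ _ _ _ ayu ayp.
Qed.

Lemma adj_contract_direct hd a u v : wf a -> adj a u v ->
  ~~ dies hd a u -> ~~ dies hd a v -> adj (contract hd a) u v.
Proof.
move=> wa /adjP[j [p auj]] du dv; apply/adjP; exists j, p.
exact: contract_direct.
Qed.

Lemma adj_contract_via hd a u y v : wf a -> compresses hd a y ->
  adj a u y -> adj a y v -> u != v -> adj (contract hd a) u v.
Proof.
move=> wa cy /adjP[j [p auj]] /adjP[p' [q ayp]] uv; apply/adjP; exists j, q.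
have pp' : p != p'; last exact: contract_via auj cy ayp pp'.
by apply: contra uv => /eqP pp'; move: ayp; rewrite -pp' (wf_sym wa auj) => -[->].
Qed.

Lemma nonleaf_contract hd a u v : wf a -> adj a u v -> ~~ leaf a v ->
  ~~ dies hd a u -> exists2 w, adj (contract hd a) u w &
    w = v \/ [/\ compresses hd a v, adj a v w & w != u].
Proof.
move=> wa uv lv du; case dv : (dies hd a v); last first.
  by exists v; [apply: adj_contract_direct; rewrite ?dv|left].
have vu : adj a v u by rewrite adj_sym.
move: dv; rewrite (dies_adj _ vu) => /orP[/rakes_leaf|cv]; first by rewrite (negbTE lv).
have [w vw wu] := leafPn lv vu wa; exists w; last by right.
by apply: adj_contract_via cv uv vw _; rewrite // eq_sym.
Qed.

(** A leaf survives only next to a smaller leaf, and that one rakes. *)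
Lemma leaf_survivors hd a u v : wf a -> adj a u v -> ~~ dies hd a u ->
  ~~ dies hd a v -> ~~ leaf a v.
Proof.
move=> wa uv; have vu : adj a v u by rewrite adj_sym.
rewrite (dies_adj _ uv) (dies_adj _ vu) !negb_or => /andP[ru _] /andP[rv _].
apply/negP => lv; move: rv; rewrite (rakesE lv vu) negb_or negbK => /andP[lu].
move: ru; rewrite (rakesE lu uv) lv /= -!leNgt => vu' uv'.
have /eqP E : u == v by rewrite eq_le uv' vu'.
by rewrite E adj_irr in uv.
Qed.

(** Contraction could create parallel edges in two ways: an edge beside a bypass with the same ends,
    which needs a triangle, or two such bypasses, which need a square. Both cycles are sets of
    minimum degree two. *)
Lemma no_triangle a u v w : wf a -> adj a u v -> adj a v w -> adj a w u -> False.
Proof.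
move=> wa uv vw wu.
have : [set u; v; w] != set0 by apply/set0Pn; exists u; rewrite !inE eqxx.
case/eqP; apply: (wf_core wa) => x; rewrite !inE.
have [nuv nvw nwu] : [/\ u != v, v != w & w != u].
  by split; apply/eqP => E; move: uv vw wu; rewrite E adj_irr.
have [vu wv uw] : [/\ adj a v u, adj a w v & adj a u w] by split; rewrite adj_sym.
case/orP=> [/orP[]|]/eqP ->.
- by exists v, w; rewrite !inE !eqxx ?orbT.
- by exists w, u; rewrite !inE !eqxx ?orbT.
- by exists u, v; rewrite !inE !eqxx ?orbT.
Qed.

Lemma no_square a u v w z : wf a -> adj a u v -> adj a v w -> adj a w z ->
  adj a z u -> u != w -> v != z -> False.
Proof.
move=> wa uv vw wz zu nuw nvz.
have : [set u; v; w; z] != set0 by apply/set0Pn; exists u; rewrite !inE eqxx.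
case/eqP; apply: (wf_core wa) => x; rewrite !inE.
have [vu wv zw uz] : [/\ adj a v u, adj a w v, adj a z w & adj a u z].
  by split; rewrite adj_sym.
case/orP=> [/orP[/orP[]|]|]/eqP ->.
- by exists v, z; rewrite !inE !eqxx ?orbT.
- by exists u, w; rewrite !inE !eqxx ?orbT.
- by exists v, z; rewrite !inE !eqxx ?orbT.
- by exists u, w; rewrite !inE !eqxx ?orbT.
Qed.

Lemma contract_wf hd a : wf a -> wf (contract hd a).
Proof.
move=> wa; split.
- move=> u j v p /(contractP wa)[/= du dv [auj|]].
    by apply: contract_direct => //; exact: wf_sym.
  case=> [y [q [q' [auj cy qq' ayq]]]].
  by apply: contract_via (wf_sym wa ayq) cy (wf_sym wa auj) _; rewrite 1?eq_sym.
- move=> u j j' v p p' /(contractP wa)[/= du dv auj] /(contractP wa)[/= _ _ auj'].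
  case: auj auj' => [auj|[y [q [q' [auj cy qq' ayq]]]]] [auj'|[z [r [r' [auj' cz rr' azr]]]]].
  + exact: wf_uniq auj auj'.
  + case: (no_triangle wa (adj_slot auj) (adj_slot (wf_sym wa azr))).
    by rewrite adj_sym // (adj_slot auj').
  + case: (no_triangle wa (adj_slot auj') (adj_slot (wf_sym wa ayq))).
    by rewrite adj_sym // (adj_slot auj).
  + case: (eqVneq y z) auj' cz azr => [<- auj' _ _|yz auj' _ azr].
      exact: wf_uniq auj auj'.
    case: (no_square wa (adj_slot auj) (adj_slot ayq) (adj_slot (wf_sym wa azr))
             (adj_slot (wf_sym wa auj'))) => //.
    apply: contra qq' => /eqP uv; subst v.
    by rewrite (wf_uniq wa ayq (wf_sym wa auj)).
- move=> u j p /(contractP wa)[/= du _ [/(wf_irr wa)//|]].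
  move=> [y [q [q' [auj cy qq' ayq]]]].
  by rewrite (wf_uniq wa ayq (wf_sym wa auj)) eqxx in qq'.
- move=> X coreX.
  (* A core [X] of the contracted arrays is pulled back by adding the compressed vertices between
     its members; each contracted edge then lifts to an edge of [a] inside [X :|: Y]. *)
  pose Y := [set y | compresses hd a y & [forall w, adj a y w ==> (w \in X)]].
  have lift_adj x y : x \in X -> y \in X -> adj (contract hd a) x y ->
      exists z, [/\ z \in X :|: Y, adj a x z, ~~ dies hd a y &
        z = y \/ [/\ compresses hd a z, adj a z y & x != y]].
    move=> xX yX /(adj_contract wa)[dx dy [xy|[z [cz xz zy xy]]]].
      by exists y; rewrite inE yX; split=> //; left.
    exists z; split=> //; last by right.
    rewrite !inE cz; apply/orP; right; apply/forallP => w; apply/implyP.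
    case: (compressesP wa cz) => [v [v' [_ _ _ vv' _]]].
    have zx : adj a z x by rewrite adj_sym.
    move=> /vv' wv; case: (vv' _ zx) => xv; case: (vv' _ zy) => yv;
      case: wv => -> ; rewrite -?xv -?yv //.
    + by rewrite xv yv eqxx in xy.
    + by rewrite xv yv eqxx in xy.
  suff /eqP : X :|: Y = set0 by rewrite setU_eq0 => /andP[/eqP].
  apply: (wf_core wa) => x; rewrite inE => /orP[xX|]; last first.
    rewrite inE => /andP[cx /forallP xX].
    have [v [w [vw xv xw _ _]]] := compressesP wa cx.
    exists v, w; rewrite !inE vw xv xw.
    by rewrite (implyP (xX v)) // (implyP (xX w)).
  have [y [z [yX zX yz xy xz]]] := coreX x xX.
  have [y1 [y1X xy1 dy y1y]] := lift_adj _ _ xX yX xy.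
  have [z1 [z1X xz1 dz z1z]] := lift_adj _ _ xX zX xz.
  (* Two contracted edges of [x] with the same first step have the same far end: a compressed vertex
     has a single neighbor besides [x], and a survivor is not compressed. *)
  exists y1, z1; split=> //; apply: contra yz => /eqP E; subst z1.
  case: y1y z1z => [E|[cy1 y1y nxy]] [E'|[cz1 y1z nxz]].
  + by rewrite -E E'.
  + by rewrite -E (compresses_dies cz1) in dy.
  + by rewrite -E' (compresses_dies cy1) in dz.
  have y1x : adj a y1 x by rewrite adj_sym.
  case: (compressesP wa cy1) => [v [v' [_ _ _ vv' _]]].
  by apply/eqP; case: (vv' _ y1x) (vv' _ y1y) (vv' _ y1z) nxy nxz => -> [->|->] [->|->];
    rewrite ?eqxx.
Qed.

(** * Counting the vertices that one round deletes *)

Lemma card_sum (T : finType) (B : {set T}) (r : pred T) :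
  #|[set u in B | r u]| = \sum_(u in B) r u.
Proof.
rewrite -sum1_card; transitivity (\sum_(u | (u \in B) && r u) 1).
  by apply: eq_bigl => u; rewrite inE.
by rewrite big_mkcondr; apply: eq_bigr => u _; case: (r u).
Qed.

Section Degeneracy.
Variable e : rel V.
Hypothesis e_sym : symmetric e.

(* Removing a vertex of degree at most one loses at most one edge. *)
Lemma acyclic_edges (B : {set V}) :
  (forall X : {set V}, (forall x, x \in X -> exists y z,
     [/\ y \in X, z \in X, y != z, e x y & e x z]) -> X = set0) ->
  (forall x, ~~ e x x) ->
  \sum_(u in B) #|[set v in B | e u v]| <= 2 * #|B|.
Proof.
move=> core e_irr; have [n] := ubnP #|B|; elim: n B => // n IHn B ltBn.
have [->|B0] := eqVneq B set0; first by rewrite big_set0.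
have [x [xB xle]] : exists x, x \in B /\ #|[set v in B | e x v]| <= 1.
  apply: contrapT => nx; move/eqP: B0; apply; apply: core => x xB.
  have /card_gt1P[y [z [yP zP yz]]] : 1 < #|[set v in B | e x v]|.
    by rewrite ltnNge; apply/negP => le1; apply: nx; exists x.
  move: yP zP; rewrite !inE => /andP[yB xy] /andP[zB xz].
  by exists y, z.
have cB : #|B| = (#|B :\ x|).+1 by rewrite (cardsD1 x) xB.
have {IHn} := IHn (B :\ x); rewrite -ltnS -cB => /(_ ltBn) IH.
rewrite (big_setD1 x xB) /=.
have -> : \sum_(u in B :\ x) #|[set v in B | e u v]| =
  \sum_(u in B :\ x) (#|[set v in B :\ x | e u v]| + e x u).
  apply: eq_bigr => u _; rewrite (cardsD1 x) !inE xB /= addnC e_sym.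
  by congr (_ + _); apply: eq_card => v; rewrite !inE andbA.
rewrite big_split /= cB mulnS addnCA -mulnS mulnS addnC leq_add //.
have -> : \sum_(u in B :\ x) e x u = #|[set v in B | e x v]|.
  rewrite -card_sum; apply: eq_card => u; rewrite !inE.
  by case: eqP => [->|_] //=; rewrite (negbTE (e_irr x)) andbF.
by rewrite -[2]/(1 + 1) leq_add.
Qed.
End Degeneracy.

(** The part of [compresses] that earlier rounds determine; given it, the three coins of the present
    round are still free. *)
Definition pliable a u :=
  if nbrs a u is [:: (v, _); (v', _)] then ~~ leaf a v && ~~ leaf a v'
  else false.

Definition frontier a (B : {set V}) :=
  [set u in B | [exists v, adj a u v && (v \notin B)]].

Lemma not_frontier a (B : {set V}) u v : u \in B -> u \notin frontier a B -> adj a u v ->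
  v \in B.
Proof.
move=> uB; rewrite inE uB /= => /existsPn/(_ v) + uv; by rewrite uv negbK.
Qed.

(** Applied to leaves only, so the default [u] never shows. Images under this map let leaves pay for
    their neighbors. *)
Definition leaf_nbr_of a u : V := odflt u [pick v | adj a u v].

Lemma leaf_nbr_ofE a u v : leaf a u -> adj a u v -> leaf_nbr_of a u = v.
Proof.
move=> lu uv; rewrite /leaf_nbr_of; case: pickP => [w uw|/(_ v)]; last by rewrite uv.
exact: leaf_nbr uw uv.
Qed.

(** Off the frontier all neighbors lie in [B], so vertices with three or more neighbors are paid for
    by those with fewer. The count yields coefficients 3 for isolated and 6 for raking vertices;
    both are raised to 8, the inverse of the probability that a pliable vertex compresses. *)
Lemma contraction_count a (B : {set V}) : wf a ->
  #|B| <= 8 * #|[set u in B | nilp (nbrs a u) || rakes a u]|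
          + #|[set u in B | pliable a u]| + 6 * #|frontier a B|.
Proof.
move=> wa; set F := frontier a B; set P := [set u in B | pliable a u].
pose I := [set u in B | nilp (nbrs a u)].
pose L := [set u in B | leaf a u].
pose M := [set u in B | rakes a u].
pose Q := [set u in B | [&& u \notin F, size (nbrs a u) == 2 & ~~ pliable a u]].
have -> : #|[set u in B | nilp (nbrs a u) || rakes a u]| = #|I| + #|M|.
  rewrite -cardsUI [I :&: M](_ : _ = set0) ?cards0 ?addn0; last first.
    apply/setP => u; rewrite !inE; case: (u \in B) => //=.
    by rewrite /rakes; case: (nbrs a u).
  by apply: eq_card => u; rewrite !inE; case: (u \in B).
have edges := acyclic_edges (adj_sym wa) B (@wf_core _ wa) (fun x => negbT (adj_irr x wa)).
(* A vertex with two neighbors that is not pliable is the only neighbor of some leaf. *)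
have QL : #|Q| <= #|L|.
  apply: leq_trans (leq_imset_card (leaf_nbr_of a) L); apply: subset_leq_card.
  apply/fintype.subsetP => u; rewrite inE => /and4P[uB uF sz pu].
  have [v uv lv] : exists2 v, adj a u v & leaf a v.
    move: pu sz; rewrite /pliable; case eq_n: (nbrs a u) => [|[x p] [|[y q] []]] //.
    rewrite negb_and !negbK => /orP[] l _; [exists x|exists y] => //;
    by rewrite (adj_nbrs2 eq_n) eqxx ?orbT.
  have vu : adj a v u by rewrite adj_sym.
  apply/imsetP; exists v; last by rewrite (leaf_nbr_ofE lv vu).
  by rewrite inE lv (not_frontier uB uF uv).
(* A leaf off the frontier that does not rake is joined to one that does; charging it there gives
   the factor 2. *)
have LM : #|L| <= 2 * #|M| + #|F|.
  have LS : L \subset M :|: F :|: leaf_nbr_of a @: M.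
    apply/fintype.subsetP => u; rewrite inE => /andP[uB lu]; rewrite !in_setU.
    case uF: (u \in F); first by rewrite orbT.
    rewrite inE uB /=; case ru : (rakes a u) => //=; have [v uv _] := leafP lu.
    have vu : adj a v u by rewrite adj_sym.
    move: (ru); rewrite (rakesE lu uv); case lv: (leaf a v) => //= uv'.
    apply/imsetP; exists v; last by rewrite (leaf_nbr_ofE lv vu).
    rewrite inE (not_frontier uB (negbT uF) uv) (rakesE lv vu) lu /=.
    rewrite lt_neqAle leNgt uv' andbT.
    by apply/eqP => E; rewrite E adj_irr in uv.
  move/subset_leq_card in LS; apply: leq_trans LS _.
  apply: leq_trans (leq_card_setU _ _) _.
  apply: leq_trans (leq_add (leq_card_setU _ _) (leq_imset_card _ _)) _.
  lia.
(* Each vertex off the frontier contributes at least 3 on the right: its degree, plus 3 if isolated,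
   2 if a leaf, and 1 for exactly two neighbors, as a pliable vertex or as a member of [Q]. *)
have count : 3 * #|B| <= \sum_(u in B) #|[set v in B | adj a u v]|
    + 3 * #|F| + 3 * #|I| + 2 * #|L| + #|P| + #|Q|.
  have -> : #|F| = \sum_(u in B) (u \in F).
    by rewrite -card_sum; apply: eq_card => u; rewrite !inE; case: (u \in B).
  rewrite !card_sum -sum1_card !big_distrr -!big_split /=.
  apply: leq_sum => u uB; case uF: (u \in F); first by lia.
  have -> : #|[set v in B | adj a u v]| = size (nbrs a u).
    rewrite size_nbrs //; apply: eq_card => v; rewrite !inE.
    case uv: (adj a u v); rewrite ?andbF // andbT.
    exact: not_frontier uB (negbT uF) uv.
  rewrite /leaf; case: (nbrs a u) => [|? [|? [|? s]]] //=.
  by case: pliable.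
lia.
Qed.

Lemma size_nbrs_count a u :
  size (nbrs a u) = count (fun j => isSome (a u j)) (enum 'I_t).
Proof. by rewrite /nbrs size_pmap count_map; apply: eq_count. Qed.

(** This is why MR writes the correct leaf bit. All leaf neighbors of a survivor rake, whereas a
    nonleaf neighbor survives or is bypassed, so exactly the nonleaf neighbors leave a filled
    slot. *)
Lemma leaf_contract hd a u : wf a -> ~~ dies hd a u ->
  leaf (contract hd a) u =
  (count id [seq (if a u j is Some (v, _) then ~~ leaf a v else false)
            | j <- enum 'I_t] == 1).
Proof.
move=> wa du; rewrite /leaf size_nbrs_count count_map; congr (_ == 1).
apply: eq_count => j /=; case auj: (a u j) => [[v p]|]; last first.
  by rewrite /contract (negbTE du) auj.
have uv := adj_slot auj; have vu : adj a v u by rewrite adj_sym.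
case dv: (dies hd a v); last first.
  by rewrite (contract_direct wa auj du) ?dv // (leaf_survivors wa uv du) ?dv.
move: (dv); rewrite (dies_adj _ vu); case rv: (rakes a v) => /=.
  by rewrite /contract (negbTE du) auj rv -[size _ == 1]/(leaf a v) rakes_leaf.
move=> cv; have [p' [y [pp' avp' _ _]]] := compresses_other wa cv (wf_sym wa auj).
by rewrite (contract_via wa auj cv avp' pp') /leaf (compresses_size cv).
Qed.

End Contraction.

(** * MR implements contraction *)

Section Programs.
Variables Loc Val : eqType.
Implicit Types (m : memory Loc Val).

Lemma result_bind X Y (p : prog Loc Val X) (f : X -> prog Loc Val Y) m :
  result m (bind p f) = result m (f (result m p)).
Proof. by elim: p => //= l k IH; rewrite IH. Qed.

Lemma reads_bind X Y (p : prog Loc Val X) (f : X -> prog Loc Val Y) m :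
  reads m (bind p f) = reads m p ++ reads m (f (result m p)).
Proof. by elim: p => //= l k IH; rewrite IH. Qed.

Lemma writes_bind X Y (p : prog Loc Val X) (f : X -> prog Loc Val Y) m :
  writes m (bind p f) = writes m p ++ writes m (f (result m p)).
Proof. by elim: p => [x|l k IH|l v k IH] //=; rewrite IH. Qed.

Lemma result_mapM X Y (f : X -> prog Loc Val Y) s m :
  result m (mapM f s) = [seq result m (f x) | x <- s].
Proof. by elim: s => //= x s IH; rewrite !result_bind IH. Qed.

Lemma reads_mapM X Y (f : X -> prog Loc Val Y) s m :
  reads m (mapM f s) = flatten [seq reads m (f x) | x <- s].
Proof. by elim: s => //= x s IH; rewrite !reads_bind IH cats0. Qed.

Lemma writes_mapM X Y (f : X -> prog Loc Val Y) s m :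
  writes m (mapM f s) = flatten [seq writes m (f x) | x <- s].
Proof. by elim: s => //= x s IH; rewrite !writes_bind IH cats0. Qed.

Lemma foldl_update_same m l v ws : m l = Some v ->
  (forall v', (l, v') \in ws -> v' = v) -> foldl (@update Loc Val) m ws l = Some v.
Proof.
elim: ws m => //= -[l' v'] ws IH m ml vs; apply: IH => [|w lw]; last first.
  by apply: vs; rewrite inE lw orbT.
rewrite /update /=; case: eqP => // E; subst l'.
by rewrite (vs v') // mem_head.
Qed.

(** The order of commits is irrelevant as soon as all writes to a location agree. For MR it then
    suffices that every write carries the intended value and that some write takes place. *)
Lemma foldl_update m l v ws : (l, v) \in ws ->
  (forall v', (l, v') \in ws -> v' = v) -> foldl (@update Loc Val) m ws l = Some v.
Proof.
elim: ws m => //= -[l' v'] ws IH m lin vs.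
have vs' w : (l, w) \in ws -> w = v by move=> lw; apply: vs; rewrite inE lw orbT.
move: lin; rewrite inE => /orP[/eqP[<- <-]|lin]; last exact: IH.
by apply: foldl_update_same; rewrite // /update /= eqxx.
Qed.

Lemma size_flatten_le (X Y : Type) (f : X -> seq Y) c s :
  (forall x, size (f x) <= c) -> size (flatten [seq f x | x <- s]) <= c * size s.
Proof.
move=> fc; elim: s => //= x s IH; rewrite size_cat mulnS; exact: leq_add.
Qed.

End Programs.

Section MRCorrect.
Variables (t : nat) (disp : Order.disp_t) (V : finOrderType disp).
Local Open Scope set_scope.
Local Notation slots := (V -> 'I_t -> slot t V).
Local Notation mem_t := (memory (loc t V) (Defs.val t V)).
Implicit Types (a : slots) (S : {set V}) (m : mem_t) (heads : nat -> V -> bool).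

(** The term [3 * t] covers the slots read, and the leaf bits read and slots written by a vertex
    that stays alive. *)
Lemma MR_cost heads i u m : cost m (MR t heads i u) <= 3 * t + 8.
Proof.
have stay_reads (a : seq (slot t V)) : size a <= t -> size (reads m (stay i u a)) <= t.
  move=> sa; rewrite /stay reads_bind reads_mapM /= cats0.
  apply: leq_trans (@size_flatten_le _ _ _ 1 _ _) _ => [[j [[v p]|]]|] //.
  by rewrite mul1n size_zip geq_min sa orbT.
have stay_writes (a : seq (slot t V)) : size a <= t -> size (writes m (stay i u a)) <= t.+1.
  move=> sa; rewrite /stay writes_bind writes_mapM /= size_cat /= addn1 ltnS.
  apply: leq_trans (@size_flatten_le _ _ _ 1 _ _) _ => [[j [[v p]|]]|] //.
  by rewrite mul1n size_zip geq_min sa orbT.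
rewrite /cost /MR ![reads m (bind _ _)]reads_bind ![writes m (bind _ _)]writes_bind.
rewrite reads_mapM writes_mapM result_mapM /=.
set A := [seq (if m (LocA i u x) is Some (ValSlot s) then s else None) | x <- enum 'I_t].
have sA : size A <= t by rewrite size_map size_enum_ord.
have r0 : size (flatten [seq [:: @LocA t V i u x] | x <- enum 'I_t]) <= t.
  by apply: leq_trans (@size_flatten_le _ _ _ 1 _ _) _; rewrite ?mul1n ?size_enum_ord.
have -> : flatten [seq [::] | x <- enum 'I_t] = [::] :> seq (loc t V * Defs.val t V).
  by elim: (enum 'I_t).
move: (stay_reads A sA) (stay_writes A sA); move: (stay i u A) => st.
rewrite size_cat /=.
case: (pmap id A) => [|[v p] [|[v' p'] [|x s]]] /=; rewrite ?reads_bind ?writes_bind /=.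
- lia.
- case: ifP => _; last by lia.
  by rewrite /=; case: ifP => _ /=; lia.
- by case: ifP => _ /=; lia.
- lia.
Qed.

(** Restricted to live vertices: a survivor also writes into the slots of a neighbor that dies in
    the same round, so the memory of dead vertices may deviate from the arrays. *)
Definition represents i S a m :=
  (forall u j, u \in S -> m (LocA i u j) = Some (ValSlot (a u j))) /\
  (forall u, u \in S -> m (LocLeaf i u) = Some (ValLeaf (leaf a u))).

Definition stay_slot_write i a u j : seq (loc t V * Defs.val t V) :=
  if a u j is Some (v, p) then [:: (LocA i.+1 v p, ValSlot (Some (u, j)))]
  else [:: (LocA i.+1 u j, ValSlot None)].

Definition MR_writes hd i a u : seq (loc t V * Defs.val t V) :=
  if ~~ dies hd a u then
    flatten [seq stay_slot_write i a u j | j <- enum 'I_t]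
    ++ [:: (LocLeaf i.+1 u, ValLeaf (leaf (contract hd a) u))]
  else
    match nbrs a u with
    | [:: (v, p)] => [:: (LocA i.+1 v p, ValSlot None)]
    | [:: (v, p); (v', p')] =>
        [:: (LocA i.+1 v p, ValSlot (Some (v', p')));
            (LocA i.+1 v' p', ValSlot (Some (v, p)))]
    | _ => [::]
    end ++ [:: (LocD u, ValRound i)].

Section Round.
Variables (S : {set V}) (a : slots) (m : mem_t) (i : nat) (heads : nat -> V -> bool).
Hypotheses (wa : wf a) (suppS : forall u v, adj a u v -> u \in S).
Hypothesis mP : represents i S a m.
Let hd := heads i.

Lemma read_slots u : u \in S ->
  [seq result m (read_slot i u j) | j <- enum 'I_t] = [seq a u j | j <- enum 'I_t].
Proof. by move=> uS; apply: eq_map => j /=; rewrite mP.1. Qed.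

Lemma result_read_leaf u : u \in S -> result m (read_leaf t i u) = leaf a u.
Proof. by move=> uS; rewrite /= mP.2. Qed.

Let map_slots (X : Type) (f : 'I_t * slot t V -> X) u :
  [seq f js | js <- zip (enum 'I_t) [seq a u j | j <- enum 'I_t]]
  = [seq f (j, a u j) | j <- enum 'I_t].
Proof. by elim: (enum 'I_t) => //= j s ->. Qed.

Lemma adj_mem u v : adj a u v -> v \in S.
Proof. by rewrite adj_sym // => /suppS. Qed.

Lemma MR_spec u : u \in S ->
  [/\ result m (MR t heads i u) = dies hd a u,
      writes m (MR t heads i u) = MR_writes hd i a u &
      forall l, l \in reads m (MR t heads i u) ->
        [\/ exists j, l = LocA i u j, l = LocLeaf i u |
            exists2 v, adj a u v & l = LocLeaf i v]].
Proof.
move=> uS.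
have reads0 l : l \in flatten [seq reads m (read_slot i u x) | x <- enum 'I_t] ->
    exists j, l = LocA i u j.
  by move=> /flattenP[_ /mapP[j _ ->]] /=; rewrite inE => /eqP ->; exists j.
(* The writes are identified for survivors only, where the leaf bit computed by [stay] is that of
   the contracted arrays. *)
have stayP : [/\ result m (stay i u [seq a u j | j <- enum 'I_t]) = false,
    (~~ dies hd a u -> writes m (stay i u [seq a u j | j <- enum 'I_t]) =
        MR_writes hd i a u)
  & forall l, l \in reads m (stay i u [seq a u j | j <- enum 'I_t]) ->
        exists2 v, adj a u v & l = LocLeaf i v].
  rewrite /stay result_bind reads_bind writes_bind result_mapM reads_mapM writes_mapM.
  rewrite !map_slots /= cats0; split=> // [du|l].
    rewrite /MR_writes du (leaf_contract wa du); congr (flatten _ ++ [:: (_, ValLeaf (count id _ == 1))]).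
      by apply: eq_map => j; rewrite /= /stay_slot /stay_slot_write /=; case: (a u j) => [[]|].
    apply: eq_map => j; rewrite /= /stay_slot /=; case auj: (a u j) => [[v p]|] //.
    by rewrite /= mP.2 // (adj_mem (adj_slot auj)).
  case/flattenP => _ /mapP[j _ ->] /=; rewrite /stay_slot /=.
  case auj: (a u j) => [[v p]|] //=; rewrite inE => /eqP ->; exists v => //.
  exact: adj_slot auj.
have memA u' v : adj a u' v -> result m (read_leaf t i v) = leaf a v.
  by move=> /adj_mem/result_read_leaf.
rewrite /MR !result_bind !reads_bind !writes_bind reads_mapM writes_mapM result_mapM.
rewrite read_slots // result_read_leaf // -/(nbrs a u).
have -> : flatten [seq writes m (read_slot i u x) | x <- enum 'I_t] = [::].
  by elim: (enum 'I_t).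
rewrite cat0s [writes m (read_leaf _ _ _)]/= cat0s.
case: stayP => sr sw srd.
have stay_case : ~~ dies hd a u ->
  [/\ result m (stay i u [seq a u j | j <- enum 'I_t]) = dies hd a u,
      writes m (stay i u [seq a u j | j <- enum 'I_t]) = MR_writes hd i a u &
      forall l, l \in reads m (stay i u [seq a u j | j <- enum 'I_t]) ->
          exists2 v, adj a u v & l = LocLeaf i v].
  by move=> du; rewrite sr sw // (negbTE du).
have readsP s : (forall l, l \in s -> exists2 v, adj a u v & l = LocLeaf i v) ->
  forall l, l \in flatten [seq reads m (read_slot i u x) | x <- enum 'I_t] ++
     reads m (read_leaf t i u) ++ s ->
     [\/ exists j, l = LocA i u j, l = LocLeaf i u |
            exists2 v, adj a u v & l = LocLeaf i v].
  move=> sP l; rewrite !mem_cat => /orP[/reads0|/orP[]]; first by constructor 1.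
    by rewrite inE => /eqP ->; constructor 2.
  by move/sP; constructor 3.
case eq_n: (nbrs a u) => [|[v p] [|[v' p'] [|x s]]].
- have du : dies hd a u by rewrite /dies eq_n.
  by rewrite du /MR_writes du eq_n; split=> //; apply: readsP.
- have lu : leaf a u by rewrite /leaf eq_n.
  have uv : adj a u v by rewrite (adj_nbrs1 eq_n).
  rewrite lu !result_bind !reads_bind !writes_bind (memA _ _ uv).
  rewrite [writes m (read_leaf _ _ _)]/= cat0s -(rakesE lu uv).
  have dE : dies hd a u = rakes a u by rewrite /dies /compresses eq_n /= orbF.
  case: ifP dE => ru dE.
    rewrite dE /MR_writes dE eq_n; split=> //.
    by apply: readsP => l; rewrite inE => /eqP ->; exists v.
  have [|-> -> rP] := stay_case; first by rewrite dE.
  split=> //; apply: readsP => l; rewrite inE => /orP[/eqP ->|/rP//].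
  by exists v.
- have [uv uv'] : adj a u v /\ adj a u v'.
    by rewrite !(adj_nbrs2 eq_n) !eqxx orbT.
  rewrite !result_bind !reads_bind !writes_bind (memA _ _ uv).
  rewrite (memA _ _ uv').
  rewrite ![writes m (read_leaf _ _ _)]/= !cat0s.
  rewrite (_ : [&& _, _, _, _ & _] = compresses hd a u); last first.
    by rewrite /compresses eq_n.
  have dE : dies hd a u = compresses hd a u by rewrite /dies /rakes eq_n.
  case: ifP dE => cu dE.
    rewrite dE /MR_writes dE eq_n; split=> //.
    by apply: readsP => l; rewrite !inE => /orP[]/eqP ->; [exists v|exists v'].
  have [|-> -> rP] := stay_case; first by rewrite dE.
  split=> //; apply: readsP => l; rewrite !inE.
  by case/orP=> [/eqP->|/orP[/eqP ->|/rP//]]; [exists v|exists v'].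
- have [|-> -> rP] := stay_case; first by rewrite /dies /rakes /compresses eq_n.
  by split=> //; apply: readsP.
Qed.

Let S' := [set u in S | ~~ dies hd a u].

Let writes_round :=
  flatten [seq writes m (MR t heads i u) | u <- enum S].

Let in_writes l x : reflect (exists2 u, u \in S & (l, x) \in MR_writes hd i a u)
  ((l, x) \in writes_round).
Proof.
apply: (iffP flattenP) => [[s /mapP[u uS ->]]|[u uS lu]].
  move: uS; rewrite mem_enum => uS; have [_ -> _] := MR_spec uS; by move=> lx; exists u.
exists (MR_writes hd i a u); rewrite // -mem_enum in uS *; apply/mapP; exists u => //.
rewrite mem_enum in uS; by have [_ -> _] := MR_spec uS.
Qed.

Let in_stay_writes u l x : (l, x) \in flatten [seq stay_slot_write i a u j | j <- enum 'I_t] ->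
  exists j, (exists v p, [/\ a u j = Some (v, p), l = LocA i.+1 v p & x = ValSlot (Some (u, j))])
   \/ [/\ a u j = None, l = LocA i.+1 u j & x = ValSlot None].
Proof.
case/flattenP => _ /mapP[j _ ->]; rewrite /stay_slot_write.
case auj: (a u j) => [[v p]|]; rewrite inE => /eqP[-> ->]; exists j; last by right.
by left; exists v, p.
Qed.

Lemma MR_write_slot u w q x : u \in S -> ~~ dies hd a w ->
  (LocA i.+1 w q, x) \in MR_writes hd i a u -> x = ValSlot (contract hd a w q).
Proof.
move=> uS dw; rewrite /MR_writes; case: ifPn => [du|].
  rewrite mem_cat => /orP[|]; last by rewrite inE => /eqP.
  case/in_stay_writes=> j [[v [p [auj [wv qp] ->]]]|[auj [-> ->] ->]].
    by subst v p; rewrite (contract_direct wa (wf_sym wa auj)).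
  by rewrite /contract (negbTE du) auj.
rewrite negbK => du; rewrite mem_cat => /orP[|]; last by rewrite inE => /eqP.
case eq_n: (nbrs a u) => [|[v p] [|[v' p'] []]] //.
  rewrite inE => /eqP[wv qp ->]; subst w q.
  have /mem_nbrs[j auj] : (v, p) \in nbrs a u by rewrite eq_n mem_head.
  move: du; rewrite /dies eq_n /compresses eq_n orbF /= => ru.
  by rewrite /contract (negbTE dw) (wf_sym wa auj) ru.
have cu : compresses hd a u.
  by move: du; rewrite /dies eq_n /rakes eq_n.
have /mem_nbrs[j auj] : (v, p) \in nbrs a u by rewrite eq_n mem_head.
have /mem_nbrs[j' auj'] : (v', p') \in nbrs a u by rewrite eq_n !inE eqxx orbT.
have jj' : j != j'.
  have := nbrs_uniq u wa; rewrite eq_n /= inE andbT; apply: contra => /eqP E.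
  by move: auj; rewrite E auj' => -[->].
rewrite !inE => /orP[]/eqP[-> -> ->].
  by rewrite (contract_via wa (wf_sym wa auj) cu auj').
by rewrite (contract_via wa (wf_sym wa auj') cu auj) // eq_sym.
Qed.

Lemma MR_write_leaf u w x : u \in S ->
  (LocLeaf i.+1 w, x) \in MR_writes hd i a u -> x = ValLeaf (leaf (contract hd a) w).
Proof.
move=> uS; rewrite /MR_writes; case: ifPn => [du|du].
  rewrite mem_cat => /orP[|]; last by rewrite inE => /eqP[-> ->].
  by case/in_stay_writes=> j [[v [p [auj ]]]|[auj ]].
rewrite mem_cat => /orP[|]; last by rewrite inE => /eqP.
by case: (nbrs a u) => [|[v p] [|[v' p'] []]] //; rewrite !inE => /eqP.
Qed.

Lemma MR_step : let c := {| contents := m; processes := S |} in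
  processes (step (MR t heads) i c) = S' /\
  represents i.+1 S' (contract hd a) (contents (step (MR t heads) i c)).
Proof.
move=> c; split.
  apply/setP => u; rewrite !inE; case uS: (u \in S) => //=.
  by have [-> _ _] := MR_spec uS.
split=> [w q|w]; rewrite inE => /andP[wS dw]; apply: foldl_update.
- suff [u uS [x ux]] : exists2 u, u \in S &
      exists x, (LocA i.+1 w q, x) \in MR_writes hd i a u.
    by apply/in_writes; exists u => //; rewrite -(MR_write_slot uS dw ux).
  have stay_write u j x : ~~ dies hd a u ->
      (LocA i.+1 w q, x) \in stay_slot_write i a u j ->
      (LocA i.+1 w q, x) \in MR_writes hd i a u.
    rewrite /MR_writes => -> xw; rewrite mem_cat; apply/orP; left; apply/flattenP.
    by exists (stay_slot_write i a u j); rewrite // map_f // mem_enum.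
  (* An empty slot is rewritten by its owner, a filled one by the neighbor it points to, whether
     that neighbor stays, rakes or compresses. *)
  case awq : (a w q) => [[u j]|]; last first.
    exists w => //; exists (ValSlot None); apply: (stay_write w q) => //.
    by rewrite /stay_slot_write awq inE.
  have auj := wf_sym wa awq; exists u; first exact: suppS (adj_slot auj).
  case: (boolP (dies hd a u)) => [du|du]; last first.
    exists (ValSlot (Some (u, j))); apply: (stay_write u j) => //.
    by rewrite /stay_slot_write auj inE.
  have : (w, q) \in nbrs a u by apply/mem_nbrs; exists j.
  rewrite /MR_writes du /=; move: du; rewrite /dies /rakes /compresses.
  case: (nbrs a u) => [|[v p] [|[v' p'] []]] // _; rewrite !inE.
    by move=> /eqP[-> ->]; exists (ValSlot None); rewrite inE eqxx.
  by case/orP=> /eqP[-> ->]; [exists (ValSlot (Some (v', p')))|exists (ValSlot (Some (v, p)))];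
    rewrite !inE eqxx ?orbT.
- move=> x /in_writes[u uS]; exact: MR_write_slot.
- apply/in_writes; exists w => //.
  by rewrite /MR_writes dw mem_cat mem_head orbT.
- by move=> x /in_writes[u uS]; exact: MR_write_leaf.
Qed.

End Round.

Section Execution.
Variables (heads : nat -> V -> bool) (A : slots).

Fixpoint arr i : slots := if i is j.+1 then contract (heads j) (arr j) else A.

Fixpoint alive i : {set V} :=
  if i is j.+1 then [set u in alive j | ~~ dies (heads j) (arr j) u] else setT.

Hypothesis wA : wf A.

Lemma arr_wf i : wf (arr i).
Proof. by elim: i => //= i; exact: contract_wf. Qed.

Lemma adj_alive i u v : adj (arr i) u v -> u \in alive i.
Proof.
elim: i u v => [|i IH] u v /=; first by rewrite inE.
case/(adj_contract (arr_wf i)) => du dv uv; rewrite inE du andbT.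
by case: uv => [/IH|[y [_ /IH]]].
Qed.

Variable E : {set {set V}}.
Hypothesis leafE : forall u, leaf A u = (degree E u == 1).

Lemma MR_state i : let c := state (MR t heads) (MR_input E A) i in
  processes c = alive i /\ represents i (alive i) (arr i) (contents c).
Proof.
elim: i => [|i /= [procE repr]].
  by split=> //; split=> [u j|u] _ /=; rewrite ?leafE.
move: procE repr; case: (state _ _ i) => m S /= -> repr.
exact: @MR_step _ _ _ i heads (arr_wf i) (@adj_alive i) repr.
Qed.

Lemma MR_runs i u : runs (MR t heads) (MR_input E A) i u = (u \in alive i).
Proof. by rewrite /runs; have [-> _] := MR_state i. Qed.

Lemma MR_terminated i : terminated (MR t heads) (MR_input E A) i = (alive i == set0).
Proof. by rewrite /terminated; have [-> _] := MR_state i. Qed.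

Lemma MR_comp_reads i u l : u \in alive i ->
  l \in comp_reads (MR t heads) (MR_input E A) i u ->
  [\/ exists j, l = LocA i u j, l = LocLeaf i u |
     exists2 v, adj (arr i) u v & l = LocLeaf i v].
Proof.
have [_ repr] := MR_state i => uS.
by have [_ _] := @MR_spec _ _ _ i heads (arr_wf i) (@adj_alive i) repr _ uS; apply.
Qed.

End Execution.

(** * Forests as inputs *)

Section Input.
Local Notation adjacent := Defs.adjacent.
Variables (E : {set {set V}}) (A : slots).
Hypotheses (EF : bounded_forest t E) (EA : encodes E A).

Lemma adjacent_sym : symmetric (adjacent E).
Proof. by move=> u v; rewrite /adjacent setUC. Qed.

Lemma adjacent_irr u : ~~ adjacent E u u.
Proof.
by apply/negP => /(proj1 (proj1 EF)); rewrite setUid cards1.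
Qed.

Lemma encodes_adj u v : adj A u v = adjacent E u v.
Proof.
apply/adjP/idP => [[j [p /(proj1 EA)[]]] //|/(proj2 EA)[j [[p Aj] _]]].
by exists j, p.
Qed.

(** The end of a longest simple path inside [X] has a neighbor in [X] other than the next vertex of
    the path. By maximality it lies on the path and closes a cycle. *)
Lemma forest_core (X : {set V}) :
  (forall x, x \in X -> exists y z,
       [/\ y \in X, z \in X, y != z, adjacent E x y & adjacent E x z]) -> X = set0.
Proof.
move=> core; apply/eqP; apply/negPn/negP => /set0Pn[x0 x0X].
pose P n := `[< exists x s, [/\ size s = n, x \in X, all (mem X) s,
   path (adjacent E) x s & uniq (x :: s)] >].
have exP : exists n, P n by exists 0; apply/asboolP; exists x0, [::].
have boundP n : P n -> n <= #|V|.
  move=> /asboolP[x [s [<- _ _ _ /card_uniqP us]]].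
  by apply: leq_trans (max_card (mem (x :: s))); rewrite us.
case: (ex_maxnP exP boundP) => n /asboolP[x [s [sn xX sX ps us]]] maxn.
have in_s y : y \in X -> adjacent E x y -> y \in s.
  move=> yX xy; apply/negPn/negP => ys.
  have : P n.+1; last by move/maxn; rewrite ltnn.
  apply/asboolP; exists y, (x :: s); split=> //=; rewrite ?sn ?xX //.
    by rewrite adjacent_sym xy.
  rewrite -/(uniq (x :: s)) us andbT inE negb_or ys andbT.
  by apply: contraTneq xy => ->; exact: adjacent_irr.
have [z [zX xz zs]] : exists z, [/\ z \in X, adjacent E x z & z != head x s].
  have [y [z [yX zX yz xy xz]]] := core x xX.
  case: (eqVneq y (head x s)) => [yE|]; last by exists y.
  by exists z; split=> //; rewrite -yE eq_sym.
have := in_s z zX xz => zin; case/splitPr: zin ps us zs => p1 p2.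
rewrite cat_path [path _ _ (_ :: _)]/= => /and3P[p1P lz _].
rewrite -cat_rcons -cat_cons cat_uniq => /andP[u1 _] zs.
suff : ~~ ucycleb (adjacent E) (x :: rcons p1 z).
  by rewrite /ucycleb u1 /= !rcons_path p1P lz last_rcons adjacent_sym xz.
(* As [z] is not the vertex next to [x] on the path, the cycle has at least three vertices. *)
apply: (proj2 (proj1 EF)).
by rewrite /= size_rcons; case: p1 zs {p1P lz u1} => //=; rewrite eqxx.
Qed.

Lemma encodes_wf : wf A.
Proof.
split.
- by move=> u j v p /(proj1 EA)[].
- move=> u j j' v p p' Aj Aj'; have [uv _] := proj1 EA _ _ _ _ Aj.
  have [k [_ kU]] := proj2 EA _ _ uv.
  by rewrite -(kU j) ?(kU j') //; [exists p'|exists p].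
- by move=> u j p /(proj1 EA)[+ _]; exact/negP/adjacent_irr.
- move=> X core; apply: forest_core => x /core[y [z []]].
  by rewrite !encodes_adj; exists y, z.
Qed.

Lemma encodes_leaf u : leaf A u = (degree E u == 1).
Proof.
rewrite /leaf size_nbrs; last exact: encodes_wf.
by congr (_ == 1); apply: eq_card => v; rewrite !inE encodes_adj.
Qed.

End Input.
End MRCorrect.

(** * Spreading of marks *)

Section Connected.
Variables (t : nat) (disp : Order.disp_t) (V : finOrderType disp).
Local Open Scope set_scope.
Local Notation slots := (V -> 'I_t -> slot t V).
Implicit Types (a : slots) (u v w x y z : V) (C Z : {set V}) (hd : V -> bool).

Definition induced a C : rel V := [rel x y | [&& x \in C, y \in C & adj a x y]].

Definition connected_in a C := forall x y, x \in C -> y \in C -> connect (induced a C) x y.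

Lemma inducedE a C x y : induced a C x y = [&& x \in C, y \in C & adj a x y].
Proof. by []. Qed.

Lemma induced_sym a C : wf a -> connect_sym (induced a C).
Proof.
move=> wa; apply: sym_connect_sym => x y.
by rewrite !inducedE adj_sym // andbCA.
Qed.

Lemma connect_induced_sub a C C' : C \subset C' ->
  subrel (connect (induced a C)) (connect (induced a C')).
Proof.
move=> /fintype.subsetP CC'; apply: connect_sub => x y /and3P[/CC' xC /CC' yC xy].
by apply: connect1; rewrite inducedE xC yC.
Qed.

Lemma connected_pendant a C Z : wf a -> connected_in a C ->
  (forall z, z \in Z -> exists2 x, x \in C & adj a z x) -> connected_in a (C :|: Z).
Proof.
move=> wa cC ZC.
have toC x : x \in C :|: Z -> exists2 y, y \in C & connect (induced a (C :|: Z)) x y.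
  rewrite inE => /orP[xC|xZ]; first by exists x.
  have [y yC xy] := ZC x xZ; exists y => //; apply: connect1.
  by rewrite inducedE !inE xZ yC orbT.
move=> x y /toC[x' x'C xx'] /toC[y' y'C yy'].
apply: connect_trans xx' _; rewrite induced_sym // in yy'; apply: connect_trans yy'.
exact: connect_induced_sub (subsetUl C Z) _ _ (cC _ _ x'C y'C).
Qed.

(* A vertex that dies is sent to one of its neighbors in [C]. *)
Lemma connected_contract hd a C : wf a -> connected_in a C ->
  connected_in (contract hd a) [set u in C | ~~ dies hd a u].
Proof.
move=> wa cC; set C' := [set u in C | _].
pose r x := if ~~ dies hd a x then x
            else odflt x [pick w | (w \in C) && adj a x w].
have wa' := contract_wf hd wa.
have step_dying x y : x \in C -> y \in C -> adj a x y -> dies hd a x ->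
    connect (induced (contract hd a) C') (r x) y.
  move=> xC yC xy dx; rewrite /r dx /=.
  have dy := dies_nbr wa xy dx.
  case: pickP => [w /andP[wC xw]|/(_ y)] /=; last by rewrite yC xy.
  have [->//|wy] := eqVneq w y.
  have cx : compresses hd a x.
    move: dx; rewrite (dies_adj _ xy) => /orP[/rakes_leaf lx|//].
    by rewrite (leaf_nbr lx xw xy) eqxx in wy.
  apply: connect1; rewrite inducedE !inE wC yC dy (dies_nbr wa xw dx) /=.
  by apply: adj_contract_via cx _ xy wy; rewrite // adj_sym.
have step x y : induced a C x y -> connect (induced (contract hd a) C') (r x) (r y).
  case/and3P=> xC yC xy; have yx : adj a y x by rewrite adj_sym.
  case: (boolP (dies hd a x)) => dx.
    have dy := dies_nbr wa xy dx.
    by rewrite {2}/r dy; apply: step_dying.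
  case: (boolP (dies hd a y)) => dy.
    by rewrite {1}/r dx induced_sym //; apply: step_dying.
  rewrite /r dx dy; apply: connect1; rewrite inducedE !inE xC yC dx dy /=.
  exact: adj_contract_direct.
move=> x y; rewrite !inE => /andP[xC dx] /andP[yC dy].
suff : connect (induced (contract hd a) C') (r x) (r y) by rewrite /r dx dy.
move: (cC x y xC yC) => /connectP[p]; elim: p x {xC dx} => [|z p IH] x /=.
  by move=> _ ->.
by case/andP => /step xz /IH{}IH /IH; exact: connect_trans.
Qed.

Lemma connected_nbr a C x y : connected_in a C -> x \in C -> y \in C -> x != y ->
  exists2 z, z \in C & adj a x z.
Proof.
move=> cC xC yC xy; case/connectP: (cC x y xC yC) => -[|z p] /=.
  by move=> _ E; rewrite E eqxx in xy.
by case/andP => /and3P[_ zC xz] _ _; exists z.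
Qed.

End Connected.

Section Infection.
Variables (t : nat) (disp : Order.disp_t) (V : finOrderType disp).
Local Open Scope set_scope.
Local Notation slots := (V -> 'I_t -> slot t V).
Implicit Types (a : slots) (u v w x y z : V) (hd : V -> bool) (B S : {set V}).

(** A vertex decides from its slots and the leaf bits of its neighbors. The third clause equates
    these bits at marked neighbors as well, whose own slots may differ, and keeps such neighbors
    from raking. *)
Record agree a a' S S' B : Prop := Agree {
  agree_alive : forall u, u \notin B -> (u \in S) = (u \in S');
  agree_slots : forall u, u \notin B -> a u =1 a' u;
  agree_nonleaf : forall u v, u \notin B -> v \in B -> adj a u v ->
    ~~ leaf a v /\ ~~ leaf a' v }.

Lemma agree_nbrs a a' S S' B u : agree a a' S S' B -> u \notin B ->
  nbrs a u = nbrs a' u.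
Proof. by move=> ag uB; rewrite /nbrs (eq_map (agree_slots ag uB)). Qed.

Lemma agree_adj a a' S S' B u v : agree a a' S S' B -> u \notin B ->
  adj a u v = adj a' u v.
Proof. by move=> ag uB; rewrite /adj (agree_nbrs ag uB). Qed.

Lemma agree_sym a a' S S' B : agree a a' S S' B -> agree a' a S' S B.
Proof.
move=> ag; split=> [u /(agree_alive ag)|u uB j|u v uB vB] //.
  by rewrite (agree_slots ag uB).
by rewrite -(agree_adj v ag uB) => /(agree_nonleaf ag uB vB)[].
Qed.

Lemma agree_leaf a a' S S' B u v : agree a a' S S' B -> u \notin B ->
  adj a u v -> leaf a v = leaf a' v.
Proof.
move=> ag uB uv; have [vB|vB] := boolP (v \in B).
  by have [/negbTE-> /negbTE->] := agree_nonleaf ag uB vB uv.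
by rewrite /leaf (agree_nbrs ag vB).
Qed.

Definition infects_by_compress hd a a' B u v :=
  [&& v \in B, adj a u v & compresses hd a v || compresses hd a' v].

Definition infects_by_leaf hd a a' B u v :=
  [&& v \in B, adj (contract hd a) u v
    & leaf (contract hd a) v || leaf (contract hd a') v].

Definition infected1 hd a a' B :=
  [set u | (u \notin B) && [exists v, infects_by_compress hd a a' B u v]].

(** Evaluated after the contraction. Vertices of [infected1] are excluded, so the contracted slots
    of the vertices considered here agree in both executions. *)
Definition infected2 hd a a' B :=
  [set u | [&& u \notin B, u \notin infected1 hd a a' B
    & [exists v, infects_by_leaf hd a a' B u v]]].

Definition spread hd a a' B := B :|: infected1 hd a a' B :|: infected2 hd a a' B.

(** Compression takes precedence, in accordance with the exclusion of [infected1] from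
    [infected2]. *)
Definition infector hd a a' B u :=
  if u \in B then u
  else if [pick v | infects_by_compress hd a a' B u v] is Some v then v
  else odflt u [pick v | infects_by_leaf hd a a' B u v].

Section Step.
Variables (hd : V -> bool) (a a' : slots) (S S' B : {set V}).
Hypotheses (wa : wf a) (wa' : wf a') (ag : agree a a' S S' B).
Let a2 := contract hd a.
Let a2' := contract hd a'.
Let N1 := infected1 hd a a' B.
Let N2 := infected2 hd a a' B.
Let B2 := spread hd a a' B.
Let inf := infector hd a a' B.

Lemma agree_rakes u : u \notin B -> rakes a u = rakes a' u.
Proof.
move=> uB; rewrite /rakes -(agree_nbrs ag uB).
case eq_n: (nbrs a u) => [|[v p] []] //.
by rewrite (agree_leaf ag uB) // (adj_nbrs1 eq_n).
Qed.

Lemma agree_compresses u : u \notin B -> compresses hd a u = compresses hd a' u.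
Proof.
move=> uB; rewrite /compresses -(agree_nbrs ag uB).
case eq_n: (nbrs a u) => [|[v p] [|[w q] []]] //.
by rewrite !(agree_leaf ag uB) // (adj_nbrs2 eq_n) eqxx ?orbT.
Qed.

Lemma agree_dies u : u \notin B -> dies hd a u = dies hd a' u.
Proof.
by move=> uB; rewrite /dies (agree_nbrs ag uB) agree_rakes ?agree_compresses.
Qed.

Lemma infected1_adj u v : u \notin B -> u \notin N1 -> v \in B -> adj a u v ->
  ~~ compresses hd a v /\ ~~ compresses hd a' v.
Proof.
move=> uB uN vB uv; move: uN; rewrite inE uB /= => /existsPn/(_ v).
by rewrite /infects_by_compress vB uv /= negb_or => /andP[].
Qed.

Lemma agree_contract u : u \notin B -> u \notin N1 -> a2 u =1 a2' u.
Proof.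
move=> uB uN j; rewrite /a2 /a2' /contract -agree_dies //; case: ifP => // _.
rewrite -(agree_slots ag uB); case auj: (a u j) => [[v p]|] //.
have uv := adj_slot auj; have [vB|vB] := boolP (v \in B); last first.
  by rewrite agree_rakes // agree_compresses // /other (agree_nbrs ag vB).
have [/negbTE-> /negbTE->] := infected1_adj uB uN vB uv.
have [lv lv'] := agree_nonleaf ag uB vB uv.
by rewrite !(contraNF (@rakes_leaf _ _ _ _ _)).
Qed.

Lemma agree_adj_contract u v : u \notin B -> u \notin N1 -> adj a2 u v = adj a2' u v.
Proof.
by move=> uB uN; rewrite /adj /nbrs (eq_map (agree_contract uB uN)).
Qed.

Lemma notin_spread u : u \notin B2 ->
  [/\ u \notin B, u \notin N1 &
   forall v, v \in B -> adj a2 u v -> ~~ leaf a2 v /\ ~~ leaf a2' v].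
Proof.
rewrite !in_setU !negb_or => /andP[/andP[uB uN1] uN2]; split=> // v vB uv.
move: uN2; rewrite inE uB uN1 /= => /existsPn/(_ v).
by rewrite /infects_by_leaf vB uv /= negb_or => /andP[].
Qed.

(** The mark of [v] came from a compressing [v0], which was a nonleaf in both executions. So [v]
    keeps [v0] or inherits its other neighbor; that neighbor is not [u], which would then have been
    infected as well. *)
Lemma infected1_nonleaf u v : u \notin B2 -> v \in N1 -> adj a2 u v -> ~~ leaf a2 v.
Proof.
move=> /notin_spread[uB uN1 _]; rewrite inE => /andP[vB /existsP[v0]].
case/and3P=> v0B vv0 cv0 uv; have [lv0 lv0'] := agree_nonleaf ag vB v0B vv0.
have vu : adj a2 v u by rewrite adj_sym //; exact: contract_wf.
have [_ dv _] := adj_contract wa uv.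
have [w vw wE] := nonleaf_contract wa vv0 lv0 dv.
apply/negP => lv; have E := leaf_nbr lv vw vu; subst w.
case: wE => [E|[cv0' v0u _]]; first by rewrite E v0B in uB.
have uv0 : adj a u v0 by rewrite adj_sym.
by have [] := infected1_adj uB uN1 v0B uv0; rewrite cv0'.
Qed.

End Step.

Lemma infected1_swap hd a a' S S' B : agree a a' S S' B ->
  infected1 hd a a' B = infected1 hd a' a B.
Proof.
move=> ag; apply/setP => u; rewrite !inE; case: (boolP (u \in B)) => //= uB.
by apply: eq_existsb => v; rewrite /infects_by_compress (agree_adj v ag uB) orbC.
Qed.

Lemma infected2_swap hd a a' S S' B : wf a -> wf a' -> agree a a' S S' B ->
  infected2 hd a a' B = infected2 hd a' a B.
Proof.
move=> wa wa' ag; apply/setP => u; rewrite [LHS]inE [RHS]inE -(infected1_swap hd ag).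
case: (boolP (u \in B)) => //= uB; case: (boolP (u \in _)) => //= uN.
apply: eq_existsb => v; rewrite /infects_by_leaf.
by rewrite (agree_adj_contract ag v uB uN) orbC.
Qed.

Lemma spread_swap hd a a' S S' B : wf a -> wf a' -> agree a a' S S' B ->
  spread hd a a' B = spread hd a' a B.
Proof.
by move=> wa wa' ag; rewrite /spread (infected1_swap hd ag) (infected2_swap hd wa wa' ag).
Qed.

Lemma spread_agree hd a a' S S' B : wf a -> wf a' -> agree a a' S S' B ->
  agree (contract hd a) (contract hd a')
    [set u in S | ~~ dies hd a u] [set u in S' | ~~ dies hd a' u]
    (spread hd a a' B).
Proof.
move=> wa wa' ag; split=> [u|u|u v].
- by case/notin_spread=> uB _ _; rewrite !inE (agree_alive ag uB) (agree_dies hd ag uB).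
- by case/notin_spread=> uB uN _; exact: (agree_contract ag).
move=> uB2; rewrite !in_setU => /orP[/orP[vB|vN1]|vN2] uv.
- by have [_ _] := notin_spread uB2; apply.
- split; first exact: (infected1_nonleaf wa ag uB2 vN1 uv).
  have [uB uN1 _] := notin_spread uB2.
  apply: (infected1_nonleaf wa' (agree_sym ag) (u := u)).
  + by rewrite -(spread_swap hd wa wa' ag).
  + by rewrite -(infected1_swap hd ag).
  + by rewrite -(agree_adj_contract ag v uB uN1).
(* In both executions [v] has two distinct neighbors: the marked vertex that infected it and the
   unmarked [u]. *)
- have [uB uN1 _] := notin_spread uB2.
  move: vN2; rewrite inE => /and3P[vB vN1 /existsP[v0 /and3P[v0B vv0 _]]].
  have nuv0 : u != v0 by apply: contraNneq uB => ->.
  have vu : adj (contract hd a) v u by rewrite adj_sym //; exact: contract_wf.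
  by split; apply: contra nuv0 => /leaf_nbr E; apply/eqP; apply: E => //;
    rewrite -(agree_adj_contract ag _ vB vN1).
Qed.

Section Labels.
Variables (hd : V -> bool) (a a' : slots) (S S' B : {set V}).
Hypotheses (wa : wf a) (wa' : wf a') (ag : agree a a' S S' B).
Hypotheses (suppS : forall u v, adj a u v -> u \in S).
Hypotheses (suppS' : forall u v, adj a' u v -> u \in S').
Let a2 := contract hd a.
Let a2' := contract hd a'.
Let N1 := infected1 hd a a' B.
Let N2 := infected2 hd a a' B.
Let B2 := spread hd a a' B.
Let inf := infector hd a a' B.
Let S2 := [set u in S | ~~ dies hd a u].

Lemma infector_id u : u \in B -> inf u = u.
Proof. by rewrite /inf /infector => ->. Qed.

Lemma infector1 u : u \in N1 -> infects_by_compress hd a a' B u (inf u).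
Proof.
rewrite inE /inf /infector => /andP[/negbTE-> /existsP[v uv]].
by case: pickP => [//|/(_ v)]; rewrite uv.
Qed.

Lemma infector2 u : u \in N2 -> infects_by_leaf hd a a' B u (inf u).
Proof.
rewrite inE /inf /infector => /and3P[uB uN /existsP[v uv]].
move: uN; rewrite inE uB => /existsPn nc; rewrite (negbTE uB).
case: pickP => [w uw|_]; first by have := nc w; rewrite uw.
by case: pickP => [//|/(_ v)]; rewrite uv.
Qed.

Lemma in_spread u : u \in B2 -> [\/ u \in B, u \in N1 | u \in N2].
Proof.
by rewrite !in_setU => /orP[/orP[]|]; [constructor 1|constructor 2|constructor 3].
Qed.

Lemma infector_mem u : u \in B2 -> inf u \in B.
Proof.
case/in_spread => [uB|/infector1/and3P[]|/infector2/and3P[]] //.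
by rewrite infector_id.
Qed.

Variable lab : V -> V.

(** Neighbors of compressing vertices join the class before the contraction, neighbors of new leaves
    after it. Each is adjacent to its infector at that moment, so both additions and the contraction
    between them preserve connectivity. *)
Lemma connected_spread j :
  connected_in a ([set u in B | lab u == j] :&: S) ->
  connected_in a2 ([set u in B2 | lab (inf u) == j] :&: S2).
Proof.
move=> cC; set C := _ :&: S in cC.
pose Z1 := [set u in N1 | lab (inf u) == j].
pose Z2 := [set u in N2 | lab (inf u) == j].
have c1 : connected_in a (C :|: Z1).
  apply: connected_pendant => // z; rewrite inE => /andP[zN lz].
  have /and3P[iB zi _] := infector1 zN; exists (inf z) => //.
  by rewrite !inE iB lz (suppS (_ : adj a _ z)) // adj_sym.
have wa2 : wf a2 by exact: contract_wf.
have c2 := connected_contract (hd := hd) wa c1.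
have c3 : connected_in a2 ([set u in C :|: Z1 | ~~ dies hd a u] :|: Z2).
  apply: connected_pendant => // z; rewrite inE => /andP[zN lz].
  have /and3P[iB zi _] := infector2 zN; exists (inf z) => //.
  have [_ di zi'] := adj_contract wa zi.
  rewrite !inE iB lz di (_ : _ \in S) //.
  case: zi' => [|[y [_ _ + _]]]; rewrite adj_sym // => /suppS //.
suff -> : [set u in B2 | lab (inf u) == j] :&: S2 =
   [set u in C :|: Z1 | ~~ dies hd a u] :|: Z2 by [].
apply/setP => u; apply/idP/idP.
  rewrite in_setI in_set => /andP[/andP[uB2 lu]]; rewrite inE => /andP[uS du].
  rewrite in_setU in_set in_setU du andbT.
  case/in_spread: uB2 => uB.
  - by rewrite [u \in C]inE in_set uB uS -{1}(infector_id uB) lu.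
  - by rewrite [u \in Z1]in_set uB lu orbT.
  - by rewrite [u \in Z2]in_set uB lu !orbT.
rewrite in_setI [u \in [set u in B2 | _]]in_set [u \in S2]in_set.
rewrite in_setU => /orP[|].
  rewrite in_set => /andP[+ ->]; rewrite andbT in_setU => /orP[|].
    rewrite in_setI in_set => /andP[/andP[uB lu] ->].
    by rewrite infector_id // lu !in_setU uB.
  rewrite in_set => /andP[uN ->]; rewrite !in_setU uN orbT /=.
  by have /and3P[_ /suppS] := infector1 uN.
rewrite in_set => /andP[uN ->]; rewrite !in_setU uN !orbT /=.
have /and3P[_ /(adj_contract wa)[-> _ uv] _] := infector2 uN; rewrite andbT.
by case: uv => [/suppS|[y [_ /suppS]]].
Qed.

Lemma frontier_contract x v : x \notin B -> x \notin N1 -> v \in B ->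
  adj a2 x v -> v \in frontier a B.
Proof.
move=> xB xN vB /(adj_contract wa)[_ _ xv]; rewrite inE vB /=; apply/existsP.
case: xv => [xv|[y [cy xy yv _]]]; first by exists x; rewrite xB adj_sym ?xv.
have [yB|yB] := boolP (y \in B); last by exists y; rewrite yB adj_sym ?yv.
by have [] := infected1_adj xB xN yB xy; rewrite cy.
Qed.

(** New frontier vertices and new marks are bounded together: the former keep the invariant of two
    per class, the latter limit the growth, and both trace back to the old frontier. *)
Let G := frontier a2 B2 :|: (B2 :\: B).

Lemma infector_frontier u : u \in G -> inf u \in frontier a B.
Proof.
have wa2 : wf a2 by exact: contract_wf.
rewrite in_setU in_setD => /orP[|/andP[uB uB2]].
  rewrite inE => /andP[uB2 /existsP[x /andP[ux xB2]]].
  have [xB xN1 _] := notin_spread xB2; have xu : adj a2 x u by rewrite adj_sym.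
  case/in_spread: uB2 => [uB|uN|uN].
  - by rewrite infector_id //; exact: frontier_contract xu.
  - have /and3P[iB ui _] := infector1 uN; move: uN; rewrite inE => /andP[uB _].
    by rewrite inE iB; apply/existsP; exists u; rewrite uB adj_sym ?ui.
  - have /and3P[iB ui _] := infector2 uN; move: uN; rewrite inE => /and3P[uB uN _].
    exact: frontier_contract ui.
case/in_spread: uB2 => [uB2|uN|uN]; first by rewrite uB2 in uB.
  have /and3P[iB ui _] := infector1 uN.
  by rewrite inE iB; apply/existsP; exists u; rewrite uB adj_sym ?ui.
have /and3P[iB ui _] := infector2 uN; move: uN; rewrite inE => /and3P[_ uN _].
exact: frontier_contract ui.
Qed.

(** A vertex that compresses in one execution leaves the frontier: a contracted edge to an unmarked
    vertex is present in both executions and needs live ends in both. *)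
Lemma fiber_compress v u0 : v \in B -> infects_by_compress hd a a' B u0 v ->
  u0 \notin B -> forall u, u \in G -> inf u = v -> u \notin B /\ adj a u v.
Proof.
move=> vB /and3P[_ u0v cv] u0B u uG iu.
have wa2 : wf a2 by exact: contract_wf.
have dead x : x \notin B -> x \notin N1 -> ~~ adj a2 x v.
  move=> xB xN; apply/negP => xv.
  have [_ dv _] := adj_contract wa xv.
  have xv' := xv; rewrite (agree_adj_contract ag v xB xN) in xv'.
  have [_ dv' _] := adj_contract wa' xv'.
  by case/orP: cv => /compresses_dies; rewrite ?(negbTE dv) ?(negbTE dv').
have uB2 : u \in B2.
  by move: uG; rewrite in_setU => /orP[|/setDP[]//]; rewrite inE => /andP[].
case/in_spread: (uB2) => uN.
- move: uG; rewrite in_setU in_setD uN orbF inE => /andP[_ /existsP[x /andP[ux xB2]]].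
  have [xB xN1 _] := notin_spread xB2.
  by have := dead x xB xN1; rewrite -iu infector_id // adj_sym // ux.
- by have /and3P[_ + _] := infector1 uN; move: uN; rewrite iu inE => /andP[].
have /and3P[_ + _] := infector2 uN; move: uN; rewrite iu inE => /and3P[uB uN1 _] uv.
by have := dead u uB uN1; rewrite uv.
Qed.

(** All vertices traced to [v] are among its two neighbors in the execution where it compresses, and
    a marked neighbor takes one of the two places. Either execution may be that one, so a marked
    neighbor is asked for in both. *)
Lemma fiber_compress_card v u0 : v \in B -> infects_by_compress hd a a' B u0 v ->
  u0 \notin B -> #|[set u in G | inf u == v]| <= 2 /\
   ((exists2 w, w \in B & adj a v w) -> (exists2 w, w \in B & adj a' v w) ->
   #|[set u in G | inf u == v]| <= 1).
Proof.
move=> vB iv u0B; have fib := fiber_compress vB iv u0B.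
have sub : [set u in G | inf u == v] \subset [set u | adj a v u] :\: B.
  apply/fintype.subsetP => u; rewrite inE => /andP[/fib uP /eqP/uP[uB uv]].
  by rewrite !inE uB adj_sym.
have sub' : [set u in G | inf u == v] \subset [set u | adj a' v u] :\: B.
  apply/fintype.subsetP => u; rewrite inE => /andP[/fib uP /eqP/uP[uB uv]].
  by rewrite !inE uB adj_sym // -(agree_adj v ag uB).
have bound (b : slots) : wf b -> compresses hd b v ->
    [set u in G | inf u == v] \subset [set u | adj b v u] :\: B ->
    #|[set u in G | inf u == v]| <= 2 /\
    ((exists2 w, w \in B & adj b v w) -> #|[set u in G | inf u == v]| <= 1).
  move=> wb /compresses_size sz /subset_leq_card le.
  rewrite size_nbrs // in sz.
  have := cardsID B [set u | adj b v u]; rewrite sz => E; split.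
    by apply: leq_trans le _; lia.
  case=> w wB vw; have : 0 < #|[set u | adj b v u] :&: B|.
    by apply/card_gt0P; exists w; rewrite !inE vw wB.
  by move: le; lia.
case/and3P: iv => _ _ /orP[cv|cv].
  by have [le2 le1] := bound a wa cv sub; split=> // /le1.
by have [le2 le1] := bound a' wa' cv sub'; split=> // _ /le1.
Qed.

(** Without compression at most one vertex is traced to [v]: either [v] itself stays on the
    frontier, or it becomes a leaf in some execution, infects its only unmarked neighbor and thereby
    leaves the frontier. *)
Lemma fiber_card v : v \in B -> #|[set u in G | inf u == v]| <= 2 /\
   ((exists2 w, w \in B & adj a v w) -> (exists2 w, w \in B & adj a' v w) ->
   #|[set u in G | inf u == v]| <= 1).
Proof.
move=> vB; have wa2 : wf a2 by exact: contract_wf.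
case: (boolP [exists u, (u \notin B) && infects_by_compress hd a a' B u v]).
  by move=> /existsP[u0 /andP[u0B iv]]; exact: fiber_compress_card iv u0B.
move=> /existsPn no1.
suff le1 : #|[set u in G | inf u == v]| <= 1 by split=> //; exact: leq_trans le1 _.
have fib u : u \in G -> inf u = v -> u = v /\ v \in frontier a2 B2 \/
   [/\ u \notin B, u \notin N1 & infects_by_leaf hd a a' B u v].
  move=> uG iu; have uB2 : u \in B2.
    by move: uG; rewrite in_setU => /orP[|/setDP[]//]; rewrite inE => /andP[].
  case/in_spread: (uB2) => uN.
  - left; rewrite -iu infector_id //; split=> //.
    by move: uG; rewrite in_setU in_setD uN orbF.
  - have := infector1 uN; move: uN; rewrite iu inE => /andP[uB _] i1.
    by have := no1 u; rewrite uB i1.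
  - have := infector2 uN; move: uN; rewrite iu inE => /and3P[uB uN1 _] i2.
    by right.
have only u x : infects_by_leaf hd a a' B u v -> u \notin B -> u \notin N1 ->
    adj a2 x v -> x \notin B -> x \notin N1 -> x = u.
  move=> /and3P[_ uv lv] uB uN xv xB xN.
  have xv' := xv; rewrite (agree_adj_contract ag v xB xN) in xv'.
  have uv' := uv; rewrite (agree_adj_contract ag v uB uN) in uv'.
  have wa2' : wf a2' by exact: contract_wf.
  by case/orP: lv => l; apply: leaf_nbr l _ _; rewrite adj_sym.
have nofront u : infects_by_leaf hd a a' B u v -> u \notin B -> u \notin N1 ->
    v \notin frontier a2 B2.
  move=> iu uB uN; apply/negP; rewrite inE => /andP[_ /existsP[x /andP[vx xB2]]].
  have [xB xN1 _] := notin_spread xB2.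
  have E : x = u by apply: only iu uB uN _ xB xN1; rewrite adj_sym.
  subst x; move: xB2; rewrite !in_setU (_ : u \in N2) ?orbT //.
  by rewrite inE uB uN; apply/existsP; exists v.
apply/card_le1_eqP => x y; rewrite in_set [y \in _]in_set.
move=> /andP[/fib xP /eqP/xP[[-> fv]|[xB xN ix]]] /andP[/fib yP /eqP/yP[[-> fv']|[yB yN iy]]] //.
- by have := nofront y iy yB yN; rewrite fv.
- by have := nofront x ix xB xN; rewrite fv'.
- by case/and3P: (iy) => _ yv _; apply: only ix xB xN yv yB yN.
Qed.

Hypothesis connS : forall j, connected_in a ([set u in B | lab u == j] :&: S).
Hypothesis connS' : forall j, connected_in a' ([set u in B | lab u == j] :&: S').
Hypothesis two_frontiers : forall j, #|[set u in frontier a B | lab u == j]| <= 2.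

(* With two frontier vertices in a class, connectivity gives each of them a
   neighbor in the class, so at most one way to spread further. *)
Lemma class_spread j : #|[set u in G | lab (inf u) == j]| <= 2.
Proof.
pose F := [set u in frontier a B | lab u == j].
have -> : #|[set u in G | lab (inf u) == j]| = \sum_(v in F) #|[set u in G | inf u == v]|.
  rewrite -sum1_card (partition_big inf (mem F)) /=; last first.
    by move=> u; rewrite in_set => /andP[/infector_frontier iF lu]; rewrite in_set iF.
  apply: eq_bigr => v; rewrite in_set => /andP[_ /eqP lv].
  rewrite -[RHS]sum1_card; apply: eq_bigl => u; rewrite !in_set -andbA.
  by congr (_ && _); case: (eqVneq (inf u) v) => [->|_]; rewrite ?andbF // lv eqxx.
have FB v : v \in F -> v \in B by rewrite !inE => /andP[/andP[]].
have FS v : v \in F -> v \in [set u in B | lab u == j] :&: S /\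
    v \in [set u in B | lab u == j] :&: S'.
  rewrite !inE => /andP[/andP[-> /existsP[u /andP[vu uB]]] ->] /=.
  rewrite (suppS vu) (suppS' (_ : adj a' v u)) //.
  by rewrite adj_sym // -(agree_adj _ ag uB) adj_sym.
have [F1|F2] := leqP #|F| 1.
  apply: leq_trans (_ : \sum_(v in F) 2 <= 2).
    by apply: leq_sum => v /FB/fiber_card[].
  by rewrite sum_nat_const; move: F1; case: #|F| => [|[]].
apply: leq_trans (two_frontiers j); rewrite -sum1_card; apply: leq_sum => v vF.
have /set0Pn[w] : F :\ v != set0 by rewrite -card_gt0; move: F2; rewrite (cardsD1 v) vF.
rewrite in_setD1 => /andP[wv wF]; rewrite eq_sym in wv.
have [vS vS'] := FS v vF; have [wS wS'] := FS w wF.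
have [z + vz] := connected_nbr (connS (j := j)) vS wS wv.
have [z' + vz'] := connected_nbr (connS' (j := j)) vS' wS' wv.
rewrite !inE => /andP[/andP[zB' _] _] /andP[/andP[zB _] _].
have [_ le1] := fiber_card (FB v vF).
by apply: le1; [exists z|exists z'].
Qed.

End Labels.

Lemma infector_swap hd a a' S S' B : agree a a' S S' B ->
  infector hd a a' B =1 infector hd a' a B.
Proof.
move=> ag u; rewrite /infector; case: (boolP (u \in B)) => // uB.
have e1 : infects_by_compress hd a a' B u =1 infects_by_compress hd a' a B u.
  by move=> v; rewrite /infects_by_compress (agree_adj v ag uB) orbC.
rewrite -(eq_pick e1); case: pickP => // no1; congr (odflt u _); apply: eq_pick => v.
have uN : u \notin infected1 hd a a' B.
  by rewrite inE uB; apply/existsPn => w; rewrite no1.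
by rewrite /infects_by_leaf (agree_adj_contract ag v uB uN) orbC.
Qed.

(** Marks outlive their vertices, so a class is connected only in its live part, which differs
    between the executions. The frontier is common to both, since edges at unmarked vertices
    agree. *)
Record tracked a a' S S' B (lab : V -> V) : Prop := Tracked {
  tracked_agree : agree a a' S S' B;
  tracked_conn : forall j, connected_in a ([set u in B | lab u == j] :&: S);
  tracked_conn' : forall j, connected_in a' ([set u in B | lab u == j] :&: S');
  tracked_frontier : forall j, #|[set u in frontier a B | lab u == j]| <= 2 }.

Lemma tracked_spread hd a a' S S' B lab : wf a -> wf a' ->
  (forall u v, adj a u v -> u \in S) -> (forall u v, adj a' u v -> u \in S') ->
  tracked a a' S S' B lab ->
  tracked (contract hd a) (contract hd a')
    [set u in S | ~~ dies hd a u] [set u in S' | ~~ dies hd a' u]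
    (spread hd a a' B) (lab \o infector hd a a' B) /\
  forall j, #|[set u in spread hd a a' B :\: B | lab (infector hd a a' B u) == j]| <= 2.
Proof.
move=> wa wa' sS sS' [ag cc cc' ff].
have class j := class_spread hd wa wa' ag sS sS' cc cc' ff j.
split=> [|j]; last first.
  apply: leq_trans (class j); apply: subset_leq_card; apply/fintype.subsetP => u.
  by rewrite !in_set => /andP[-> ->]; rewrite orbT.
split; first exact: spread_agree.
- by move=> j; exact: connected_spread.
- move=> j; have := connected_spread (hd := hd) (a' := a) wa' sS' (cc' j).
  rewrite (spread_swap hd wa wa' ag); congr (connected_in _ (_ :&: _)).
  by apply/setP => u; rewrite !in_set /= (infector_swap hd ag).
- move=> j; apply: leq_trans (class j); apply: subset_leq_card.
  by apply/fintype.subsetP => u; rewrite !in_set => /andP[-> ->].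
Qed.

End Infection.

(** * Marked vertices in two executions *)

Section TwoExecutions.
Variables (t : nat) (disp : Order.disp_t) (V : finOrderType disp).
Local Open Scope set_scope.
Local Notation slots := (V -> 'I_t -> slot t V).
Local Notation adjacent := Defs.adjacent.
Implicit Types (heads : nat -> V -> bool).

Lemma card_classes (T : finType) (lab : T -> T) (X Y : {set T}) c :
  (forall u, u \in X -> lab u \in Y) ->
  (forall j, #|[set u in X | lab u == j]| <= c) -> #|X| <= c * #|Y|.
Proof.
move=> XY le; rewrite -sum1_card (partition_big lab (mem Y)) //= mulnC -sum_nat_const.
apply: leq_sum => j _; apply: leq_trans (le j); rewrite -sum1_card leq_eqVlt.
by apply/orP; left; apply/eqP/eq_bigl => u; rewrite inE.
Qed.

Lemma card_bigcup_le (I T : finType) (X : {set I}) (F : I -> {set T}) c :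
  (forall i, i \in X -> #|F i| <= c) -> #|\bigcup_(i in X) F i| <= #|X| * c.
Proof.
move=> Fc; rewrite -sum_nat_const; apply: (@leq_trans (\sum_(i in X) #|F i|)); last exact: leq_sum.
elim/big_rec2: _ => [|i n Y _ le]; first by rewrite cards0.
by apply: leq_trans (leq_card_setU _ _) _; rewrite leq_add2l.
Qed.

Section Marked.
Variables (A A' : slots) (B0 : {set V}).

(* The vertices that may be affected before round [i], and the initial vertex
   to which their marking is traced back. *)
Fixpoint marked heads i : {set V} * (V -> V) :=
  if i is j.+1 then
    let: (B, lab) := marked heads j in
    (spread (heads j) (arr heads A j) (arr heads A' j) B,
     lab \o infector (heads j) (arr heads A j) (arr heads A' j) B)
  else (B0, id).

Hypotheses (wA : wf A) (wA' : wf A').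
Hypothesis tracked0 : tracked A A' setT setT B0 id.

Lemma marked_tracked heads i :
  tracked (arr heads A i) (arr heads A' i) (alive heads A i) (alive heads A' i)
    (marked heads i).1 (marked heads i).2 /\
  forall u, u \in (marked heads i).1 -> (marked heads i).2 u \in B0.
Proof.
elim: i => //= i [tr labB].
have [tr' _] := tracked_spread (heads i) (arr_wf heads wA i) (arr_wf heads wA' i)
  (@adj_alive _ _ _ heads _ wA i) (@adj_alive _ _ _ heads _ wA' i) tr.
case: (marked heads i) tr labB tr' => B lab /= tr labB tr'; split=> // u uB.
by apply: labB; exact: infector_mem uB.
Qed.

Lemma marked_new heads i :
  #|(marked heads i.+1).1 :\: (marked heads i).1| <= 2 * #|B0|.
Proof.
have [_ labB] := marked_tracked heads i.+1.
have [tr _] := marked_tracked heads i.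
have [_ new] := tracked_spread (heads i) (arr_wf heads wA i) (arr_wf heads wA' i)
  (@adj_alive _ _ _ heads _ wA i) (@adj_alive _ _ _ heads _ wA' i) tr.
apply: (card_classes (lab := (marked heads i.+1).2)) => [u /setDP[/labB]//|j].
by move: new => /=; case: (marked heads i) => B lab /= /(_ j).
Qed.

Lemma marked_frontier heads i :
  #|frontier (arr heads A i) (marked heads i).1| <= 2 * #|B0|.
Proof.
have [tr labB] := marked_tracked heads i.
apply: (card_classes (lab := (marked heads i).2)); last exact: tracked_frontier tr.
by move=> u; rewrite inE => /andP[/labB].
Qed.

Lemma marked_frontier' heads i :
  #|frontier (arr heads A' i) (marked heads i).1| <= 2 * #|B0|.
Proof.
have [[ag _ _ _] _] := marked_tracked heads i.
apply: leq_trans (marked_frontier heads i); apply: subset_leq_card.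
apply/fintype.subsetP => v; rewrite !inE => /andP[-> /existsP[u /andP[vu uB]]].
apply/existsP; exists u; rewrite uB andbT adj_sym; last exact: arr_wf.
by rewrite (agree_adj _ ag uB) adj_sym //; exact: arr_wf.
Qed.

Variables (E E' : {set {set V}}).
Hypothesis leafE : forall u, leaf A u = (degree E u == 1).
Hypothesis leafE' : forall u, leaf A' u = (degree E' u == 1).

Lemma affected_marked heads i u :
  affected (MR t heads) (MR_input E A) (MR_input E' A') i u -> u \in (marked heads i).1.
Proof.
have [[ag _ _ _] _] := marked_tracked heads i.
apply: contraLR => uB; rewrite /affected !MR_runs // (agree_alive ag uB) eqxx /=.
case uS': (u \in alive heads A' i) => //; have uS := agree_alive ag uB; rewrite uS' in uS.
apply/hasPn => l.
have [_ [mA mL]] := MR_state heads wA leafE i.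
have [_ [mA' mL']] := MR_state heads wA' leafE' i.
have same_slot j : contents (state (MR t heads) (MR_input E A) i) (LocA i u j) =
    contents (state (MR t heads) (MR_input E' A') i) (LocA i u j).
  by rewrite mA // mA' // (agree_slots ag uB).
have same_leaf : contents (state (MR t heads) (MR_input E A) i) (LocLeaf i u) =
    contents (state (MR t heads) (MR_input E' A') i) (LocLeaf i u).
  by rewrite mL // mL' // /leaf (agree_nbrs ag uB).
have same_nbr v : adj (arr heads A i) u v ->
    contents (state (MR t heads) (MR_input E A) i) (LocLeaf i v) =
    contents (state (MR t heads) (MR_input E' A') i) (LocLeaf i v).
  move=> uv; have uv' := uv; rewrite (agree_adj v ag uB) in uv'.
  rewrite mL ?mL' ?(agree_leaf ag uB uv) //.
    by apply: (adj_alive (v := u) wA'); rewrite adj_sym //; exact: arr_wf.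
  by apply: (adj_alive (v := u) wA); rewrite adj_sym //; exact: arr_wf.
rewrite negbK mem_cat => /orP[lr|lr].
  by case: (MR_comp_reads wA leafE uS lr) => [[j ->]|->|[v uv ->]];
    apply/eqP; [exact: same_slot|exact: same_leaf|exact: same_nbr].
case: (MR_comp_reads wA' leafE' uS' lr) => [[j ->]|->|[v uv ->]];
  apply/eqP; [exact: same_slot|exact: same_leaf|apply: same_nbr].
by rewrite (agree_adj v ag uB).
Qed.

End Marked.

(** * Dependence on earlier coins only *)

Lemma arr_local (A : slots) heads heads' i :
  (forall j, j < i -> heads j = heads' j) -> arr heads A i = arr heads' A i.
Proof.
elim: i => [_|i IH e]; first by [].
change (contract (heads i) (arr heads A i) = contract (heads' i) (arr heads' A i)).
by rewrite IH => [|j ji]; [rewrite e|apply: e; exact: ltnW].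
Qed.

Lemma alive_local (A : slots) heads heads' i :
  (forall j, j < i -> heads j = heads' j) -> alive heads A i = alive heads' A i.
Proof.
elim: i => [_|i IH e]; first by [].
have ei j : j < i -> heads j = heads' j by move=> ji; apply: e; exact: ltnW.
rewrite [LHS]/= [RHS]/=; have -> := arr_local A ei; have -> := IH ei.
by have -> : heads i = heads' i by exact: e.
Qed.

Lemma marked_local (A A' : slots) B0 heads heads' i :
  (forall j, j < i -> heads j = heads' j) ->
  marked A A' B0 heads i = marked A A' B0 heads' i.
Proof.
elim: i => [_|i IH e]; first by [].
have ei j : j < i -> heads j = heads' j by move=> ji; apply: e; exact: ltnW.
rewrite [LHS]/= [RHS]/=; have -> := arr_local A ei; have -> := arr_local A' ei.
by have -> := IH ei; have -> : heads i = heads' i by exact: e.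
Qed.

Lemma state_local A E heads heads' i : (forall j, j < i -> heads j = heads' j) ->
  state (MR t heads) (MR_input E A) i = state (MR t heads') (MR_input E A) i.
Proof.
elim: i => //= i IH e; rewrite IH; last by move=> j ji; apply: e; exact: ltnW.
have MRE u : MR t heads i u = MR t heads' i u by rewrite /MR e.
rewrite /step; congr Config; last by apply/setP => u; rewrite !inE MRE.
by congr (foldl _ _ (flatten _)); apply: eq_map => u; rewrite MRE.
Qed.

Lemma comp_cost_local A E heads heads' i u : (forall j, j <= i -> heads j = heads' j) ->
  comp_cost (MR t heads) (MR_input E A) i u = comp_cost (MR t heads') (MR_input E A) i u.
Proof.
move=> e; rewrite /comp_cost (@state_local _ _ heads heads'); last first.
  by move=> j ji; apply: e; exact: ltnW.
by congr cost; rewrite /MR e.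
Qed.

(** Compressions stay on the left: averaged over the coins, their term equals that of the pliable
    vertices on the right, and the two cancel. *)
Lemma contraction_step hd (a : slots) (B : {set V}) : wf a ->
  8 * #|[set u in B | ~~ dies hd a u]| + 8 * #|[set u in B | compresses hd a u]|
  <= 7 * #|B| + #|[set u in B | pliable a u]| + 6 * #|frontier a B|.
Proof.
move=> wa; have := contraction_count B wa.
have -> : #|B| = #|[set u in B | ~~ dies hd a u]| + #|[set u in B | compresses hd a u]|
     + #|[set u in B | nilp (nbrs a u) || rakes a u]|.
  rewrite !card_sum -!big_split -sum1_card; apply: eq_bigr => u _ /=.
  rewrite /dies; case: (nilp _) / (@idP (nilp (nbrs a u))) => [/nilP n0|_].
    by rewrite /compresses n0.
  case ru: (rakes a u) => //=; last by case: compresses.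
  by rewrite /compresses; move: ru; rewrite /rakes; case: (nbrs a u) => [|[? ?] []].
lia.
Qed.

(** * Initial marks *)

Section InitialMarking.
Variables (k : nat) (E E' : {set {set V}}) (A A' : slots).
Hypotheses (EF : bounded_forest t E) (EF' : bounded_forest t E').
Hypotheses (EA : encodes E A) (EA' : encodes E' A').
Hypotheses (EE' : modified k E E') (AA' : same_slots E E' A A').

Definition changed := cover ((E :\: E') :|: (E' :\: E)).

Definition nbrhood (a : slots) (D : {set V}) := \bigcup_(d in D) [set v | adj a d v].

(** Including the neighbors makes marked vertices nonleaves as seen from unmarked ones: a marked
    vertex next to an unmarked one is not itself changed, so it has a changed neighbor besides. *)
Definition initially_marked :=
  changed :|: nbrhood A changed :|: nbrhood A' changed.

Lemma card_modified (ms : seq (modification V)) (F : {set {set V}}) :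
  #|(F :\: foldl (@modify V) F ms) :|: (foldl (@modify V) F ms :\: F)| <= size ms.
Proof.
elim/last_ind: ms => [|ms m IH]; first by rewrite /= setDv setU0 cards0.
rewrite foldl_rcons size_rcons; set F1 := foldl _ _ _ in IH *.
pose e := match m with Insert e => e | Delete e => e end.
apply: (@leq_trans #|e |: ((F :\: F1) :|: (F1 :\: F))|).
  apply: subset_leq_card; apply/fintype.subsetP => x.
  by rewrite {}/e; case: m => f /=; rewrite !inE; case: (x == f).
by apply: leq_trans (leq_card_setU _ _) _; rewrite cards1 add1n.
Qed.

Lemma card_changed : #|changed| <= 2 * k.
Proof.
have [+ _] := leq_card_cover ((E :\: E') :|: (E' :\: E)); move/leq_trans; apply.
(* A modification may name any set of vertices, but a set on which the two forests differ is an edge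
   of one of them and has two elements. *)
rewrite (eq_bigr (fun _ => 2)); last first.
  move=> e; rewrite !inE => /orP[] /andP[_]; first exact: (proj1 (proj1 EF)).
  exact: (proj1 (proj1 EF')).
rewrite sum_nat_const mulnC leq_mul2l /=.
by case: EE' => ms [<- E'E]; rewrite -E'E; exact: card_modified.
Qed.

Lemma card_nbrhood F (a : slots) D : bounded_forest t F -> encodes F a ->
  #|nbrhood a D| <= #|D| * t.
Proof.
move=> FF Fa; apply: card_bigcup_le => d _; apply: leq_trans (proj2 FF d).
apply: subset_leq_card; apply/fintype.subsetP => v; rewrite !inE.
by rewrite (encodes_adj Fa).
Qed.

Lemma card_initially_marked : #|initially_marked| <= 2 * (2 * t).+1 * k.
Proof.
have := card_nbrhood changed EF EA; have := card_nbrhood changed EF' EA'.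
have := card_changed; rewrite /initially_marked => c n' n.
apply: leq_trans (leq_card_setU _ _) _.
apply: leq_trans (leq_add (leq_card_setU _ _) n') _.
apply: leq_trans (leq_add (leq_add (leqnn _) n) (leqnn _)) _.
by nia.
Qed.

Lemma mem_nbrhood (a : slots) (D : {set V}) d v : d \in D -> adj a d v ->
  v \in nbrhood a D.
Proof. by move=> dD dv; apply/bigcupP; exists d; rewrite ?inE. Qed.

Lemma unchanged_adj u v : u \notin changed -> adj A u v = adj A' u v.
Proof.
move=> uD; rewrite (encodes_adj EA) (encodes_adj EA') /Defs.adjacent.
apply/idP/idP => uv; apply: contraNT uD => uv'; apply/bigcupP;
  by exists [set u; v]; rewrite !inE ?eqxx // uv uv' ?orbT.
Qed.

Lemma unchanged_slots u : u \notin changed -> A u =1 A' u.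
Proof.
move=> uD j; case Auj: (A u j) => [[v p]|].
  have uv := adj_slot Auj; have uv' := uv; rewrite unchanged_adj // in uv'.
  rewrite (encodes_adj EA) in uv; rewrite (encodes_adj EA') in uv'.
  by apply/esym/AA'.
case Auj': (A' u j) => [[v p]|] //.
have uv' := adj_slot Auj'; have uv := uv'; rewrite -unchanged_adj // in uv.
rewrite (encodes_adj EA) in uv; rewrite (encodes_adj EA') in uv'.
by have := proj2 (AA' j p uv uv') Auj'; rewrite Auj.
Qed.

Lemma unchanged_leaf u : u \notin changed -> leaf A u = leaf A' u.
Proof.
by move=> uD; rewrite /leaf /nbrs (eq_map (unchanged_slots uD)).
Qed.

Lemma initially_agree : agree A A' setT setT initially_marked.
Proof.
have wA := encodes_wf EF EA; have wA' := encodes_wf EF' EA'.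
have notin u : u \notin initially_marked ->
    [/\ u \notin changed, forall d, d \in changed -> ~~ adj A d u &
        forall d, d \in changed -> ~~ adj A' d u].
  rewrite !in_setU !negb_or => /andP[/andP[uD uA] uA']; split=> // d dD.
    by apply: contra uA; exact: mem_nbrhood.
  by apply: contra uA'; exact: mem_nbrhood.
split=> [//|u /notin[uD _ _]|u v /notin[uD uA uA'] vB uv].
  exact: unchanged_slots.
have vu : adj A v u by rewrite adj_sym.
have vD : v \notin changed by apply/negP => /uA; rewrite vu.
rewrite -(unchanged_leaf vD); suff nl : ~~ leaf A v by [].
apply/negP => lv; move: vB; rewrite !in_setU (negbTE vD) /=.
case/orP => /bigcupP[d dD]; rewrite inE => dv.
  have vd : adj A v d by rewrite adj_sym.
  by move: uD; rewrite (leaf_nbr lv vu vd) dD.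
have vd : adj A v d by rewrite unchanged_adj // adj_sym.
by move: uD; rewrite (leaf_nbr lv vu vd) dD.
Qed.

Lemma initially_tracked : tracked A A' setT setT initially_marked id.
Proof.
have conn (a : slots) j :
    connected_in a ([set u in initially_marked | id u == j] :&: setT).
  move=> x y; rewrite !inE !andbT => /andP[_ /eqP ->] /andP[_ /eqP ->].
  exact: connect0.
split=> //; first exact: initially_agree.
move=> j; apply: leq_trans (_ : #|[set j]| <= 2); last by rewrite cards1.
by apply: subset_leq_card; apply/fintype.subsetP => u; rewrite !inE => /andP[_ ->].
Qed.

End InitialMarking.
End TwoExecutions.

(** * Counting over coin flips *)

Section Coins.
Variables (t : nat) (disp : Order.disp_t) (V : finOrderType disp).
Local Open Scope set_scope.
Local Notation slots := (V -> 'I_t -> slot t V).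
Implicit Types (heads : nat -> V -> bool).

(** Locality makes a quantity measurable, turns its expectation into a finite average, and separates
    it from the coins of round [i]. *)
Definition local X i (F : (nat -> V -> bool) -> X) :=
  forall heads heads', (forall j, j < i -> heads j = heads' j) -> F heads = F heads'.

Variable N : nat.
Local Notation coins := {ffun 'I_N * V -> bool}.

Definition extend (x : coins) : nat -> V -> bool :=
  fun i v => if insub i is Some j then x (j, v) else false.

Lemma extendE x (j : 'I_N) v : extend x j v = x (j, v).
Proof. by rewrite /extend valK. Qed.

Definition flip (c : 'I_N * V) (x : coins) : coins := [ffun c' => x c' (+) (c' == c)].

Lemma flipK c : involutive (flip c).
Proof. by move=> x; apply/ffunP => c'; rewrite !ffunE addbK. Qed.

(** Flipping [c] matches the arrays of either outcome of this coin with those of the other, at equal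
    values of [G]. *)
Lemma sum_flip c b (G : coins -> nat) : (forall x, G (flip c x) = G x) ->
  2 * \sum_x G x * (x c == b) = \sum_x G x.
Proof.
move=> Gc; rewrite mul2n -addnn.
rewrite {2}(reindex_inj (can_inj (flipK c))) /= -big_split /=.
apply: eq_bigr => x _; rewrite Gc !ffunE eqxx addbT -mulnDr.
by case: (x c); case: b; rewrite muln1.
Qed.

Lemma local_flip X (F : (nat -> V -> bool) -> X) (j : 'I_N) v x :
  local j F -> F (extend (flip (j, v) x)) = F (extend x).
Proof.
apply=> i ij; apply/funext => u; have iN := ltn_trans ij (ltn_ord j).
rewrite -[i]/(nat_of_ord (Ordinal iN)) !extendE ffunE -[RHS]addbF; congr (_ (+) _).
by apply/negbTE; rewrite xpair_eqE negb_and -val_eqE /= ltn_eqF.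
Qed.

Lemma sum_three_flips (F : (nat -> V -> bool) -> nat) (j : 'I_N) u v w :
  local j F -> u != v -> u != w -> v != w ->
  8 * \sum_x F (extend x) * [&& x (j, u), ~~ x (j, v) & ~~ x (j, w)]
  = \sum_x F (extend x).
Proof.
move=> Fj uv uw vw.
have neq u1 u2 : u1 != u2 -> ((j, u1) == (j, u2)) = false.
  by move=> /negbTE n; rewrite xpair_eqE n andbF.
rewrite -[RHS](sum_flip (c := (j, u)) true); last by move=> x; rewrite local_flip.
rewrite -[in RHS](sum_flip (c := (j, v)) false); last first.
  by move=> x; rewrite local_flip // !ffunE neq // addbF.
rewrite -[in RHS](sum_flip (c := (j, w)) false); last first.
  by move=> x; rewrite local_flip // !ffunE !neq // !addbF.
rewrite !mulnA; congr (_ * _); apply: eq_bigr => x _; rewrite -!mulnA; congr (_ * _).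
by case: (x (j, u)); case: (x (j, v)); case: (x (j, w)).
Qed.

(** Which coins decide a compression depends on the earlier ones. Summing over all vertices and all
    pairs of neighbor entries fixes the three vertices, and each summand becomes an indicator of the
    past times three fresh coins. *)
Lemma sum_compresses (A : slots) (B : (nat -> V -> bool) -> {set V}) (i : 'I_N) :
  wf A -> local i B ->
  8 * \sum_x #|[set u in B (extend x) |
                 compresses (extend x i) (arr (extend x) A i) u]|
  = \sum_x #|[set u in B (extend x) | pliable (arr (extend x) A i) u]|.
Proof.
move=> wA Bi.
pose a x := arr (extend x) A i.
pose F u (s : (V * 'I_t) * (V * 'I_t)) heads : nat :=
  [&& u \in B heads, nbrs (arr heads A i) u == [:: s.1; s.2],
      ~~ leaf (arr heads A i) s.1.1 & ~~ leaf (arr heads A i) s.2.1].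
have F_local u s : local i (F u s).
  by move=> h h' e; rewrite /F (Bi _ _ e) (arr_local A e).
have split_pairs u x (Q : V * 'I_t -> V * 'I_t -> bool) :
    ((u \in B (extend x)) &&
     (if nbrs (a x) u is [:: y; z] then
        [&& ~~ leaf (a x) y.1, ~~ leaf (a x) z.1 & Q y z] else false) : nat)
    = \sum_s F u s (extend x) * Q s.1 s.2.
  rewrite /F -/(a x); case eq_n: (nbrs (a x) u) => [|y [|z [|z' r]]];
    [by rewrite andbF big1 // => s _; rewrite andbF
    |by rewrite andbF big1 // => s _; rewrite eqseq_cons !andbF|
    |by rewrite andbF big1 // => s _; rewrite !eqseq_cons !andbF].
  rewrite (bigD1 (y, z)) //= big1 ?addn0 => [|[y' z'] /= nyz].
    by rewrite eqxx; case: (_ \in _); case: leaf; case: leaf; case: Q.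
  rewrite eqseq_cons eqseq_cons eqxx andbT.
  rewrite [_ && _ && _](_ : _ = false) ?andbF //.
  apply: contraNF nyz => /= /andP[/andP[/eqP-> /eqP->] _]; exact: eqxx.
have comprE x : #|[set u in B (extend x) | compresses (extend x i) (a x) u]| =
    \sum_u \sum_s F u s (extend x) * [&& x (i, u), ~~ x (i, s.1.1) & ~~ x (i, s.2.1)].
  rewrite card_sum big_mkcond; apply: eq_bigr => u _.
  rewrite -(split_pairs u x (fun y z => [&& x (i, u), ~~ x (i, y.1) & ~~ x (i, z.1)])).
  rewrite /compresses !extendE; case: (u \in _) => //=.
  by case: (nbrs _ _) => [|[? ?] [|[? ?] []]] //=; rewrite !extendE.
have pliE x : #|[set u in B (extend x) | pliable (a x) u]| =
    \sum_u \sum_s F u s (extend x).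
  rewrite card_sum big_mkcond; apply: eq_bigr => u _.
  transitivity (\sum_s F u s (extend x) * true); last first.
    by apply: eq_bigr => s _; rewrite muln1.
  rewrite -(split_pairs u x (fun y z => true)).
  rewrite /pliable; case: (u \in _) => //=.
  by case: (nbrs _ _) => [|[? ?] [|[? ?] []]] //=; rewrite andbT.
rewrite (eq_bigr _ (fun x _ => comprE x)) (eq_bigr _ (fun x _ => pliE x)).
rewrite exchange_big [RHS]exchange_big big_distrr; apply: eq_bigr => u _ /=.
rewrite exchange_big [RHS]exchange_big big_distrr; apply: eq_bigr => s _ /=.
(* With a repeated vertex the coins are not independent, but then the indicator vanishes: neighbors
   are distinct and differ from [u]. *)
have [/and3P[us1 us2 s12]|nd] := boolP [&& u != s.1.1, u != s.2.1 & s.1.1 != s.2.1].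
  exact: sum_three_flips.
have F0 x : F u s (extend x) = 0.
  apply/eqP; rewrite eqb0; apply: contra nd => /and4P[_ /eqP eq_n _ _].
  have := nbrs_uniq u (arr_wf (extend x) wA i); rewrite eq_n /= inE andbT => ->.
  rewrite andbT; apply/andP; split; apply/eqP => E.
    have := adj_irr u (arr_wf (extend x) wA i).
    by rewrite (adj_nbrs2 eq_n) -E eqxx.
  have := adj_irr u (arr_wf (extend x) wA i).
  by rewrite (adj_nbrs2 eq_n) -E eqxx orbT.
by rewrite !big1 // => x _; rewrite F0.
Qed.

Lemma sum_step (A : slots) (B : (nat -> V -> bool) -> {set V}) (i : 'I_N) f :
  wf A -> local i B ->
  (forall heads, #|frontier (arr heads A i) (B heads)| <= f) ->
  8 * \sum_x #|[set u in B (extend x) | ~~ dies (extend x i) (arr (extend x) A i) u]|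
  <= 7 * \sum_x #|B (extend x)| + 6 * f * #|{: coins}|.
Proof.
move=> wA Bi fB; rewrite -(leq_add2r (8 * \sum_x #|[set u in B (extend x) |
     compresses (extend x i) (arr (extend x) A i) u]|)).
rewrite {2}sum_compresses // !big_distrr -sum1_card -big_split big_distrr /=.
rewrite -!big_split /=; apply: leq_sum => x _.
apply: leq_trans (contraction_step _ _ (arr_wf (extend x) wA i)) _.
by rewrite muln1 [X in _ <= X]addnAC leq_add2l leq_mul2l fB.
Qed.

Lemma alive_decay (A : slots) i : wf A -> i <= N ->
  8 ^ i * \sum_(x : coins) #|alive (extend x) A i| <= 7 ^ i * (#|V| * #|{: coins}|).
Proof.
move=> wA; elim: i => [_|i IH iN].
  rewrite !mul1n mulnC -sum_nat_const; apply: leq_sum => x _ /=.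
  by rewrite cardsT.
have al : local i (fun h => alive h A i) by move=> h h' e; exact: alive_local.
have := sum_step (i := Ordinal iN) (f := 0) wA al.
rewrite muln0 mul0n addn0 => step.
rewrite !expnSr -mulnA (leq_trans (leq_mul (leqnn _) (step _))) //.
  (* Edges join live vertices only, so the live set has no frontier. *)
  move=> heads; rewrite leqn0 cards_eq0; apply/eqP/setP => u; rewrite !inE.
  apply/negbTE; rewrite negb_and; apply/orP; right; apply/existsPn => v.
  rewrite negb_and negbK orbC; case: (boolP (v \in _)) => //= vS.
  apply/negP => uv; case/negP: vS; apply: (adj_alive (v := u) wA).
  by rewrite adj_sym //; exact: arr_wf.
by rewrite mulnCA [_ * 7]mulnC -[_ * _ * (_ * _)]mulnA leq_mul2l /= IH // ltnW.
Qed.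

Section Marked.
Variables (A A' : slots) (B0 : {set V}).
Hypotheses (wA : wf A) (wA' : wf A').
Hypothesis tracked0 : tracked A A' setT setT B0 id.

(** With [b] initial marks, the frontier contributes [6 * 2b] and the new marks, entering after the
    contraction, [8 * 2b]. Eight times the next average is at most seven times the present one plus
    [28b], a recursion that [28b] bounds as its fixed point. *)
Lemma marked_alive_bound (C : slots) i : wf C ->
  (forall heads i, #|frontier (arr heads C i) (marked A A' B0 heads i).1| <= 2 * #|B0|) ->
  i <= N ->
  \sum_(x : coins) #|(marked A A' B0 (extend x) i).1 :&: alive (extend x) C i|
  <= 28 * #|B0| * #|{: coins}|.
Proof.
move=> wC front; elim: i => [_|i IH iN].
  rewrite [X in _ <= X]mulnC -sum_nat_const; apply: leq_sum => x _ /=.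
  by rewrite setIT leq_pmull.
have loc : local i (fun h => (marked A A' B0 h i).1 :&: alive h C i).
  by move=> h h' e; rewrite (alive_local C e) (marked_local A A' B0 e).
have := sum_step (i := Ordinal iN) (f := 2 * #|B0|) wC loc.
set X := \sum_x _; set Z := \sum_(x : coins) #|_ :&: _|; set Y := \sum_(x : coins) _ => step.
have {step} : 8 * X <= 7 * Y + 6 * (2 * #|B0|) * #|{: coins}|.
  apply: step => heads; apply: leq_trans (front heads i); apply: subset_leq_card.
  apply/fintype.subsetP => u; rewrite !inE => /andP[/andP[-> uS]] /existsP[v /andP[uv vn]].
  apply/existsP; exists v; rewrite uv; move: vn; rewrite !inE negb_and.
  rewrite (adj_alive (v := u) wC) ?orbF // adj_sym //; exact: arr_wf.
have {IH} := IH (ltnW iN); rewrite -/Y.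
have : Z <= X + 2 * #|B0| * #|{: coins}|.
  rewrite [2 * _ * _]mulnC -sum_nat_const -big_split /=; apply: leq_sum => x _.
  apply: leq_trans (leq_add (leqnn _) (marked_new wA wA' tracked0 (extend x) i)).
  apply: leq_trans (leq_card_setU _ _); apply: subset_leq_card.
  apply/fintype.subsetP => u; rewrite in_setI in_setU in_setD => /andP[uM].
  rewrite [alive _ _ _.+1]/= in_set => /andP[uS du]; rewrite uM andbT orbC; case: (boolP (u \in _)) => //= uM'.
  by rewrite in_set in_setI uM' uS.
nia.
Qed.

End Marked.
End Coins.

(** * Expectations *)

Section Series.
Variable R : realType.
Local Open Scope ring_scope.
Local Open Scope ereal_scope.

Lemma nneseries_le (u : nat -> \bar R) (M : \bar R) : (forall i, 0 <= u i) ->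
  (forall n, \sum_(0 <= i < n) u i <= M) -> \sum_(0 <= i <oo) u i <= M.
Proof.
move=> u0 uM; apply: lime_le; first exact: is_cvg_nneseries.
exact: nearW.
Qed.

Lemma partial_le_nneseries (u : nat -> \bar R) n : (forall i, 0 <= u i) ->
  \sum_(0 <= i < n) u i <= \sum_(0 <= i <oo) u i.
Proof. by move=> u0; apply: nneseries_lim_ge. Qed.

(* For each [r], the terms before [r] are bounded by [a], and the others by a
   geometric series. *)
Lemma capped_geometric_sum (g : nat -> R) (a b : R) r n :
  (0 <= a)%R -> (0 <= b)%R ->
  (forall i, g i <= a)%R -> (forall i, g i <= b * (7 / 8) ^+ i)%R ->
  (\sum_(0 <= i < n) g i <= a * r%:R + 8 * b * (7 / 8) ^+ r)%R.
Proof.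
move=> a0 b0 ga gb.
have small k : (\sum_(0 <= i < k) g i <= a * k%:R)%R.
  elim: k => [|k IH]; first by rewrite big_nil mulr0.
  by rewrite big_nat_recr //= -natr1 mulrDr mulr1 lerD.
have q0 k : (0 <= (7 / 8 : R) ^+ k)%R by rewrite exprn_ge0 // divr_ge0.
have [nr|rn] := leqP n r.
  apply: le_trans (small n) _; rewrite -[leLHS]addr0 lerD //.
    by rewrite ler_wpM2l // ler_nat.
  by rewrite !mulr_ge0.
rewrite -(subnKC (ltnW rn)).
(* The tail telescopes: with ratio 7/8, each term [b * (7 / 8) ^+ i] is the drop of
   [8 * b * (7 / 8) ^+ i] in one step. *)
suff : (\sum_(0 <= i < r + (n - r)) g i <=
   a * r%:R + 8 * b * ((7 / 8) ^+ r - (7 / 8) ^+ (r + (n - r))))%R.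
  move/le_trans; apply; rewrite lerD2l ler_wpM2l ?mulr_ge0 //.
  by rewrite gerBl.
elim: (n - r)%N => [|k IH]; first by rewrite addn0 subrr mulr0 addr0.
rewrite addnS big_nat_recr //=; apply: le_trans (lerD IH (gb _)) _.
by rewrite exprS; lra.
Qed.

End Series.

Section CoinExpectation.
Variables (disp : Order.disp_t) (V : finOrderType disp).
Variables (d : measure_display) (Omega : measurableType d) (R : realType).
Variables (P : probability Omega R) (Heads : nat * V -> {RV P >-> bool}).
Hypothesis fair : fair_coins Heads.
Local Open Scope classical_set_scope.
Local Open Scope ring_scope.
Local Open Scope ereal_scope.

Definition coins_at (w : Omega) : nat -> V -> bool := fun i v => Heads (i, v) w.

Section Horizon.
Variable N : nat.
Local Notation coins := {ffun 'I_N * V -> bool}.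

Definition observe (w : Omega) : coins := [ffun c => Heads (nat_of_ord c.1, c.2) w].

Lemma local_observe X (F : (nat -> V -> bool) -> X) w : local N F ->
  F (coins_at w) = F (extend (observe w)).
Proof.
apply=> i iN; apply/funext => v.
by rewrite -[i in RHS]/(nat_of_ord (Ordinal iN)) extendE ffunE.
Qed.

Let coords := [seq (nat_of_ord c.1, c.2) | c <- enum {: 'I_N * V}].

Lemma observeE (x : coins) : [set w | observe w = x] =
  \bigcap_(c in [set` coords]) (Heads c @^-1` [set extend x c.1 c.2]).
Proof.
apply/seteqP; split => w /=.
  move=> <- _ /mapP[c _ ->] /=.
  by case: c => i v; rewrite extendE ffunE.
move=> wx; apply/ffunP => -[i v]; rewrite ffunE -extendE.
by apply: (wx (nat_of_ord i, v)) => /=; apply/mapP; exists (i, v); rewrite ?mem_enum.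
Qed.

Lemma measurable_coin c b : measurable (Heads c @^-1` [set b]).
Proof. exact: measurable_funPTI. Qed.

Lemma measurable_observe (x : coins) : measurable [set w | observe w = x].
Proof.
rewrite observeE; apply: fin_bigcap_measurable => [|c _]; first exact: finite_seq.
exact: measurable_coin.
Qed.

Lemma coin_half c b : P (Heads c @^-1` [set b]) = (2^-1)%:E.
Proof.
have head : P (Heads c @^-1` [set true]) = (2^-1)%:E := (proj2 fair) c.
case: b => //; rewrite (_ : _ @^-1` _ = ~` (Heads c @^-1` [set true])).
  rewrite probability_setC ?head; last exact: measurable_coin.
  by rewrite -EFinB; congr EFin; lra.
by apply/seteqP; split=> w /=; case: (Heads c w).
Qed.

Lemma observe_uniform (x : coins) :
  P [set w | observe w = x] = (#|{: coins}|%:R^-1)%:E.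
Proof.
have ucoords : uniq coords.
  rewrite map_inj_uniq ?enum_uniq // => -[i v] [j u] /= [ij ->].
  by congr pair; apply/val_inj.
rewrite observeE.
rewrite ((proj1 fair) coords (fun c => [set extend x c.1 c.2]) ucoords) //.
rewrite (eq_bigr (fun _ => (2^-1)%:E)) => [|c _]; last exact: coin_half.
have -> : #|{: coins}| = (2 ^ size coords)%N by rewrite card_ffun card_bool size_map -cardE.
rewrite natrX -exprVn; elim: coords => [|c s IH].
  by rewrite big_nil expr0.
by rewrite big_cons IH exprS EFinM.
Qed.

Lemma local_preimage X (F : (nat -> V -> bool) -> X) (Y : set X) : local N F ->
  measurable [set w | Y (F (coins_at w))].
Proof.
move=> FN; rewrite (_ : [set w | _] =
   \bigcup_(x in [set x | Y (F (extend x))]) [set w | observe w = x]).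
  by apply: fin_bigcup_measurable => [|x _]; [exact: finite_finset|exact: measurable_observe].
apply/seteqP; split => w /=.
  by rewrite (local_observe w FN) => Yw; exists (observe w).
by case=> x /= Yx wx; rewrite (local_observe w FN) wx.
Qed.

Lemma measurable_local (F : (nat -> V -> bool) -> \bar R) : local N F ->
  measurable_fun [set: Omega] (fun w => F (coins_at w)).
Proof. by move=> FN _ Y _; rewrite classical_sets.setTI; exact: (@local_preimage _ F Y FN). Qed.

(** The integrand is a finite combination of indicators of the observed coin arrays, which are
    equally likely. *)
Lemma expectation_local (F : (nat -> V -> bool) -> nat) : local N F ->
  \int[P]_w (F (coins_at w))%:R%:E
  = ((\sum_(x : coins) F (extend x))%N%:R / #|{: coins}|%:R)%:E.
Proof.
move=> FN.
transitivity (\int[P]_w \sum_(x : coins)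
   ((F (extend x))%:R%:E * (\1_[set w | observe w = x] w)%:E)).
  apply: eq_integral => w _; rewrite (local_observe w FN).
  rewrite (bigD1 (observe w)) //= big1 ?adde0 => [|x /negP nx].
    by rewrite indicE mem_set // mule1.
  by rewrite indicE memNset ?mule0 //= => E; case: nx; rewrite E.
rewrite ge0_integral_sum //; last first.
  move=> x; apply: measurable_funeM; apply/measurable_EFinP.
  exact/measurable_indic/measurable_observe.
rewrite natr_sum mulr_suml -sumEFin; apply: eq_bigr => x _.
rewrite ge0_integralZl //; last first.
  by apply/measurable_EFinP; exact/measurable_indic/measurable_observe.
rewrite integral_indic //; last exact: measurable_observe.
rewrite classical_sets.setIT EFinM; congr (_ * _); exact: observe_uniform.
Qed.

Lemma expectation_local_le (F : (nat -> V -> bool) -> nat) (a b : nat) :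
  local N F -> (0 < a)%N ->
  (a * \sum_(x : coins) F (extend x) <= b * #|{: coins}|)%N ->
  \int[P]_w (F (coins_at w))%:R%:E <= (b%:R / a%:R)%:E.
Proof.
move=> FN a0 ab; rewrite expectation_local // lee_fin.
have c0 : (0 < #|{: coins}|%:R :> R)%R.
  by rewrite ltr0n; apply/card_gt0P; exists [ffun=> true].
by rewrite ler_pdivrMr // mulrAC ler_pdivlMr ?ltr0n // -!natrM ler_nat mulnC.
Qed.

End Horizon.
End CoinExpectation.

(** * Cost of a round *)

Section Rounds.
Variables (t : nat) (disp : Order.disp_t) (V : finOrderType disp).
Local Notation slots := (V -> 'I_t -> slot t V).
Implicit Types (heads : nat -> V -> bool) (E : {set {set V}}) (A : slots).

Definition round_work E A i heads :=
  \sum_(u | runs (MR t heads) (MR_input E A) i u) comp_cost (MR t heads) (MR_input E A) i u.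

Definition round_span E A i heads :=
  \max_(u | runs (MR t heads) (MR_input E A) i u) comp_cost (MR t heads) (MR_input E A) i u.

Definition round_distance E E' A A' i heads :=
  \sum_(u | affected (MR t heads) (MR_input E A) (MR_input E' A') i u)
     ((if runs (MR t heads) (MR_input E A) i u
       then comp_cost (MR t heads) (MR_input E A) i u else 0)
      + (if runs (MR t heads) (MR_input E' A') i u
         then comp_cost (MR t heads) (MR_input E' A') i u else 0)).

Lemma runs_local E A i u : local i.+1 (fun heads => runs (MR t heads) (MR_input E A) i u).
Proof.
by move=> h h' e; rewrite /runs (@state_local _ _ _ _ _ h h') // => j ji; apply: e; exact: ltnW.
Qed.

Lemma comp_reads_local E A i u :
  local i.+1 (fun heads => comp_reads (MR t heads) (MR_input E A) i u).
Proof.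
move=> h h' e; rewrite /comp_reads (@state_local _ _ _ _ _ h h'); last first.
  by move=> j ji; apply: e; exact: ltnW.
by rewrite (_ : MR t h i u = MR t h' i u) // /MR e.
Qed.

Lemma round_work_local E A i : local i.+1 (round_work E A i).
Proof.
move=> h h' e; apply: eq_big => [u|u _]; first exact: (runs_local E A u e).
exact: comp_cost_local.
Qed.

Lemma round_span_local E A i : local i.+1 (round_span E A i).
Proof.
move=> h h' e; apply: eq_big => [u|u _]; first exact: (runs_local E A u e).
exact: comp_cost_local.
Qed.

Lemma round_distance_local E E' A A' i : local i.+1 (round_distance E E' A A' i).
Proof.
move=> h h' e; apply: eq_big => [u|u _].
  rewrite /affected (runs_local E A u e) (runs_local E' A' u e).
  rewrite (comp_reads_local E A u e) (comp_reads_local E' A' u e).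
  by rewrite !(@state_local _ _ _ _ _ h h') // => j ji; apply: e; exact: ltnW.
rewrite (runs_local E A u e) (runs_local E' A' u e).
by rewrite !(@comp_cost_local _ _ _ _ _ h h').
Qed.

Section Costs.
Variables (E : {set {set V}}) (A : slots).
Hypotheses (EF : bounded_forest t E) (EA : encodes E A).
Let wA := encodes_wf EF EA.
Let leafE := encodes_leaf EF EA.

Lemma round_work_le i heads :
  round_work E A i heads <= (3 * t + 8) * #|alive heads A i|.
Proof.
rewrite mulnC -sum_nat_const /round_work.
rewrite (eq_bigl (mem (alive heads A i))); last by move=> u; rewrite MR_runs.
by apply: leq_sum => u _; exact: MR_cost.
Qed.

Lemma round_span_le i heads : round_span E A i heads <= 3 * t + 8.
Proof. by apply/bigmax_leqP => u _; exact: MR_cost. Qed.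

Lemma alive_empty heads i j : i <= j -> alive heads A i = finset.set0 ->
  alive heads A j = finset.set0.
Proof.
move=> /subnKC <- a0; elim: (j - i) => [|k IH]; first by rewrite addn0.
by rewrite addnS /= IH; apply/setP => u; rewrite !inE.
Qed.

Lemma round_span_empty heads i : alive heads A i = finset.set0 ->
  round_span E A i heads = 0.
Proof.
by move=> a0; apply: big_pred0 => u; rewrite MR_runs // a0 inE.
Qed.

End Costs.

Section Distance.
Variables (k : nat) (E E' : {set {set V}}) (A A' : slots).
Hypotheses (EF : bounded_forest t E) (EF' : bounded_forest t E').
Hypotheses (EA : encodes E A) (EA' : encodes E' A').
Hypotheses (EE' : modified k E E') (AA' : same_slots E E' A A').
Let wA := encodes_wf EF EA.
Let wA' := encodes_wf EF' EA'.
Let leafE := encodes_leaf EF EA.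
Let leafE' := encodes_leaf EF' EA'.
Let B0 := initially_marked E E' A A'.
Let M heads i := (marked A A' B0 heads i).1.

Lemma round_distance_le i heads :
  round_distance E E' A A' i heads <=
  (3 * t + 8) * (#|M heads i :&: alive heads A i|%SET
                 + #|M heads i :&: alive heads A' i|%SET).
Proof.
have cardI (X Y : {set V}) : #|X :&: Y|%SET = \sum_(u in X) (u \in Y).
  by rewrite -card_sum; apply: eq_card => u; rewrite !inE.
rewrite !cardI -big_split big_distrr /=.
rewrite /round_distance big_mkcond [X in _ <= X]big_mkcond; apply: leq_sum => u _.
case: ifP => // /(affected_marked wA wA' (initially_tracked EF EF' EA EA' AA') leafE leafE').
rewrite -/B0 -/(M heads i) => ->; rewrite !MR_runs // mulnDr.
by apply: leq_add; case: (u \in _); rewrite ?muln0 // muln1; exact: MR_cost.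
Qed.

Lemma sum_round_distance_alive N i : i <= N ->
  8 ^ i * \sum_(x : {ffun 'I_N * V -> bool}) round_distance E E' A A' i (extend x)
  <= (2 * (3 * t + 8) * 7 ^ i * #|V|) * #|{: {ffun 'I_N * V -> bool}}|.
Proof.
move=> iN; have := alive_decay wA iN; have := alive_decay wA' iN.
set a := \sum_x _; set a' := \sum_x _; set D := \sum_x _ => la la'.
have : D <= (3 * t + 8) * (a' + a).
  rewrite -big_split big_distrr; apply: leq_sum => x _ /=.
  apply: leq_trans (round_distance_le i (extend x)) _; apply: leq_mul => //.
  by apply: leq_add; apply: subset_leq_card; exact: subsetIr.
move=> le; apply: leq_trans (leq_mul (leqnn _) le) _.
rewrite mulnCA mulnDr -!mulnA [2 * _]mulnCA; apply: leq_mul => //.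
by rewrite mul2n -addnn leq_add.
Qed.

Lemma sum_round_distance_marked N i : i <= N ->
  \sum_(x : {ffun 'I_N * V -> bool}) round_distance E E' A A' i (extend x)
  <= (56 * (3 * t + 8) * (2 * (2 * t).+1) * k) * #|{: {ffun 'I_N * V -> bool}}|.
Proof.
move=> iN; have tr := initially_tracked EF EF' EA EA' AA'.
have := marked_alive_bound wA wA' tr wA (marked_frontier wA wA' tr) iN.
have := marked_alive_bound wA wA' tr wA' (marked_frontier' wA wA' tr) iN.
have := card_initially_marked EF EF' EA EA' EE'.
set b := #|_|; set a := \sum_x _; set a' := \sum_x _; set D := \sum_x _.
set T := #|{: _}| => bk la la'.
have : D <= (3 * t + 8) * (a' + a).
  rewrite -big_split big_distrr; apply: leq_sum => x _ /=.
  exact: round_distance_le.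
move=> le; apply: leq_trans le _.
apply: (@leq_trans ((3 * t + 8) * (56 * b * T))).
  by apply: leq_mul => //; move: la la'; lia.
rewrite -!mulnA [X in _ <= X]mulnCA; apply: leq_mul => //; apply: leq_mul => //.
by rewrite !mulnA; apply: leq_mul.
Qed.

End Distance.
End Rounds.

(** * The bounds *)

Section LogBounds.
Variable R : realType.
Local Open Scope ring_scope.
Implicit Types (x y : R).

Lemma ln_ge_ratio x : 0 <= x -> x / (1 + x) <= ln (1 + x).
Proof.
move=> x0; have x1 : 0 < 1 + x by rewrite ltr_wpDr.
have := expR_ge1Dx (- ln (1 + x)); rewrite expRN lnK ?posrE // => h.
suff -> : x / (1 + x) = 1 - (1 + x)^-1 by rewrite lerBlDr -lerBlDl; lra.
by field; rewrite gt_eqF.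
Qed.

Definition decay_rate : R := ln (8 / 7).

Lemma decay_rate_gt0 : 0 < decay_rate.
Proof. by rewrite /decay_rate ln_gt0 //; lra. Qed.

Lemma decay_pow r : (7 / 8 : R) ^+ r = expR (- (r%:R * decay_rate)).
Proof.
rewrite expRN expRM_natl /decay_rate lnK ?posrE; last by lra.
by rewrite -exprVn invf_div.
Qed.

Definition decay_time x := (Num.truncn (x / decay_rate)).+1.

Lemma decay_timeP x : 0 <= x -> (7 / 8) ^+ decay_time x <= expR (- x).
Proof.
move=> x0; rewrite decay_pow ler_expR lerN2 -ler_pdivrMr ?decay_rate_gt0 //.
by have /andP[_ /ltW] := truncn_itv (divr_ge0 x0 (ltW decay_rate_gt0)).
Qed.

Lemma decay_time_le x : 0 <= x -> (decay_time x)%:R <= x / decay_rate + 1.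
Proof.
move=> x0; rewrite -natr1 lerD2r.
by have /andP[] := truncn_itv (divr_ge0 x0 (ltW decay_rate_gt0)).
Qed.

End LogBounds.

Section MainBounds.
Variables (R : realType) (t : nat) (disp : Order.disp_t) (V : finOrderType disp).
Variables (d : measure_display) (Omega : measurableType d).
Variables (P : probability Omega R) (Heads : nat * V -> {RV P >-> bool}).
Hypothesis fair : fair_coins Heads.
Local Open Scope ring_scope.
Local Open Scope ereal_scope.
Local Notation slots := (V -> 'I_t -> slot t V).
Let K : R := (3 * t + 8)%:R.
Let n : R := #|V|%:R.

Lemma expected_series_le (F : nat -> (nat -> V -> bool) -> nat) (g : nat -> R) (M : R) :
  (forall i, local i.+1 (F i)) ->
  (forall i, \int[P]_w (F i (coins_at Heads w))%:R%:E <= (g i)%:E) ->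
  (forall m, (\sum_(0 <= i < m) g i <= M)%R) ->
  \int[P]_w (\sum_(0 <= i <oo) (F i (coins_at Heads w))%:R%:E) <= M%:E.
Proof.
move=> Floc Fg gM.
have F0 i w : 0 <= (F i (coins_at Heads w))%:R%:E :> \bar R by rewrite lee_fin.
rewrite integral_nneseries //; last first.
  move=> i; apply: (measurable_local Heads (F := fun h => (F i h)%:R%:E) (N := i.+1)).
  by move=> h h' e; rewrite (Floc i _ _ e).
apply: nneseries_le => [i|m]; first exact: integral_ge0.
apply: le_trans (_ : (\sum_(0 <= i < m) g i)%:E <= M%:E); last by rewrite lee_fin.
by rewrite -sumEFin; apply: lee_sum => i _.
Qed.

Section OneInput.
Variables (E : {set {set V}}) (A : slots).
Hypotheses (EF : bounded_forest t E) (EA : encodes E A).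
Let wA := encodes_wf EF EA.

Lemma pow_ratio (c : nat) i :
  ((c * 7 ^ i * #|V|)%N%:R / (8 ^ i)%N%:R = c%:R * n * (7 / 8) ^+ i :> R)%R.
Proof. by rewrite !natrM !natrX expr_div_n; field; rewrite expf_neq0. Qed.

Lemma expected_total_work :
  \int[P]_w total_work R (MR t (coins_at Heads w)) (MR_input E A)
  <= (8 * K * n)%:E.
Proof.
apply: (expected_series_le (F := round_work E A) (g := fun i => K * n * (7 / 8) ^+ i)%R).
- exact: round_work_local.
- move=> i; rewrite -pow_ratio; apply: (expectation_local_le fair (N := i.+1)).
  + exact: round_work_local.
  + by rewrite expn_gt0.
  + apply: leq_trans (_ : 8 ^ i * \sum_(x : {ffun 'I_i.+1 * V -> bool})
        ((3 * t + 8) * #|alive (extend x) A i|) <= _)%N.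
      by apply: leq_mul => //; apply: leq_sum => x _; exact: round_work_le.
    rewrite -big_distrr mulnCA -!mulnA; apply: leq_mul => //.
    exact: (alive_decay wA (leqnSn i)).
- move=> m; have Kn : (0 <= K * n)%R by rewrite mulr_ge0.
  (* Cutting at round 0 leaves the geometric series alone, whence the factor 8. *)
  apply: le_trans (capped_geometric_sum (a := K * n) 0 m Kn Kn _ _) _ => [i|i|] //.
    by rewrite ler_piMr // exprn_ile1 //; lra.
  by rewrite mulr0 add0r expr0 mulr1 mulrA.
Qed.

Lemma terminated_bounds heads r : alive heads A r = finset.set0 ->
  num_rounds R (MR t heads) (MR_input E A) <= r%:R%:E /\
  total_span R (MR t heads) (MR_input E A) <= (K * r%:R)%:E.
Proof.
move=> a0; split.
  apply: ereal_inf_lbound; exists r => //=.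
  by rewrite MR_terminated ?a0 //; exact: encodes_leaf.
apply: nneseries_le => [i|m]; first by rewrite lee_fin.
rewrite sumEFin lee_fin -natr_sum -natrM ler_nat mulnC.
have [mr|rm] := leqP m r.
  apply: leq_trans (_ : m * (3 * t + 8) <= _)%N; last by rewrite leq_mul2r mr orbT.
  rewrite -[X in (_ <= X * _)%N]subn0 -sum_nat_const_nat; apply: leq_sum => i _.
  exact: round_span_le.
rewrite (big_cat_nat (n := r)) //=; last exact: ltnW.
rewrite [X in (_ + X)%N]big_nat_cond [X in (_ + X)%N]big1 ?addn0 => [|i /andP[/andP[ri _] _]].
  rewrite -[X in (_ <= X * _)%N]subn0 -sum_nat_const_nat; apply: leq_sum => i _.
  exact: round_span_le.
by apply: (round_span_empty EF EA); exact: alive_empty ri a0.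
Qed.

(** This restates the bound by events that finitely many coins decide, as measurability requires. A
    nonempty set of rounds attains its infimum, and the infimum of the empty set is infinite. *)
Lemma num_rounds_le heads (x : R) :
  num_rounds R (MR t heads) (MR_input E A) <= x%:E <->
  exists2 r : nat, (r%:R <= x)%R & terminated (MR t heads) (MR_input E A) r.
Proof.
split=> [le|[r rx tr]]; last first.
  apply: le_trans (_ : r%:R%:E <= _); last by rewrite lee_fin.
  by apply: ereal_inf_lbound; exists r.
apply: contrapT => no.
have [[r tr]|none] := pselect (exists r, terminated (MR t heads) (MR_input E A) r).
  case: (ex_minnP (ex_intro _ r tr)) => r0 tr0 min_r0.
  have : r0%:R%:E <= x%:E.
    apply: le_trans le; apply: le_ereal_inf_tmp => _ [s ts <-].
    by rewrite lee_fin ler_nat; exact: min_r0.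
  by rewrite lee_fin => r0x; apply: no; exists r0.
move: le; rewrite /num_rounds (_ : [set _ | _ in _]%classic = classical_sets.set0).
  by rewrite ereal_inf0.
by apply/seteqP; split=> [y [s ts _]|//]; case: none; exists s.
Qed.

(** The first event is a countable union over termination rounds, the second a countable
    intersection over partial sums. *)
Lemma measurable_rounds_span (x : R) : measurable [set w |
  num_rounds R (MR t (coins_at Heads w)) (MR_input E A) <= x%:E /\
  total_span R (MR t (coins_at Heads w)) (MR_input E A) <= x%:E]%classic.
Proof.
apply: measurableI.
  rewrite (_ : (fun w => _) = (\bigcup_(r in [set r : nat | r%:R <= x]%R)
     [set w | terminated (MR t (coins_at Heads w)) (MR_input E A) r])%classic).
    apply: bigcup_measurable => r _.
    apply: (local_preimage Heads (F := fun h => terminated (MR t h) (MR_input E A) r)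
      (fun b => is_true b) (N := r)).
    by move=> h h' e; rewrite /terminated (state_local _ _ e).
  by apply/seteqP; split=> w /= => [/num_rounds_le|[r]] h; [case: h => r; exists r|move=> ?; apply/num_rounds_le; exists r].
rewrite (_ : (fun w => _) = (\bigcap_m
   [set w | \sum_(0 <= i < m) (round_span E A i (coins_at Heads w))%:R%:E <= x%:E])%classic).
  apply: bigcap_measurableType => m _.
  apply: (local_preimage Heads
    (F := fun h => \sum_(0 <= i < m) (round_span E A i h)%:R%:E : \bar R)
    (fun s => is_true (s <= x%:E)) (N := m)).
  move=> h h' e; apply: eq_big_nat => i /andP[_ im].
  by rewrite (@round_span_local _ _ _ E A i h h') // => j ji; apply: e; exact: leq_trans ji im.
have span0 i w : 0 <= (round_span E A i (coins_at Heads w))%:R%:E :> \bar R.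
  by rewrite lee_fin.
apply/seteqP; split=> w /= => [le m _|h].
  by apply: le_trans le; apply: partial_le_nneseries.
by apply: nneseries_le => // m; apply: h.
Qed.

Lemma alive_probability r :
  P [set w | alive (coins_at Heads w) A r = finset.set0]%classic
  >= (1 - n * (7 / 8) ^+ r)%:E.
Proof.
pose F h : nat := (alive h A r != finset.set0).
have Floc : local r F by move=> h h' e; rewrite /F (alive_local A e).
pose D := [set w | F (coins_at Heads w) = 1%N]%classic.
have mD : measurable D by exact: (local_preimage Heads (fun k => k = 1%N) Floc).
have -> : [set w | alive (coins_at Heads w) A r = finset.set0]%classic = (~` D)%classic.
  by apply/seteqP; split=> w; rewrite /D /F /=; case: eqP.
rewrite probability_setC // EFinB leeB // -[D]classical_sets.setIT -integral_indic //.
rewrite (eq_integral (fun w => (F (coins_at Heads w))%:R%:E)); last first.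
  move=> w _; rewrite indicE; have [wD|wD] := pselect (D w).
    by rewrite mem_set // wD.
  by rewrite memNset //; move: wD; rewrite /D /F /=; case: eqP.
have -> : (n * (7 / 8) ^+ r = (1 * 7 ^ r * #|V|)%N%:R / (8 ^ r)%N%:R :> R)%R.
  by rewrite pow_ratio mul1r.
apply: (expectation_local_le fair Floc); first by rewrite expn_gt0.
apply: leq_trans (_ : 8 ^ r * \sum_(x : {ffun 'I_r * V -> bool}) #|alive (extend x) A r| <= _)%N.
  apply: leq_mul => //; apply: leq_sum => x _; rewrite /F.
  by rewrite -card_gt0; case: #|_|.
by rewrite mul1n -mulnA; exact: (alive_decay wA (leqnn r)).
Qed.

Lemma logarithmic_rounds_span (c : R) : (0 < c)%R ->
  (1 - n `^ (- c))%:E <=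
  P [set w |
     num_rounds R (MR t (coins_at Heads w)) (MR_input E A)
       <= (K * ((c + 1) / decay_rate R + 2) * ln n)%:E
   /\ total_span R (MR t (coins_at Heads w)) (MR_input E A)
       <= (K * ((c + 1) / decay_rate R + 2) * ln n)%:E]%classic.
Proof.
move=> c0; set C := (_ * _ + 2)%R.
have K1 : (1 <= K)%R by rewrite ler1n addn_gt0 orbT.
have sub r : (K * r%:R <= K * C * ln n)%R ->
   (1 - n * (7 / 8) ^+ r)%:E <= P [set w |
     num_rounds R (MR t (coins_at Heads w)) (MR_input E A) <= (K * C * ln n)%:E
   /\ total_span R (MR t (coins_at Heads w)) (MR_input E A) <= (K * C * ln n)%:E]%classic.
  move=> rC; apply: le_trans (alive_probability r) _; apply: le_measure.
  - by apply: mem_set; apply: (local_preimage Heads (F := fun h => alive h A r)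
      (fun X => X = finset.set0) (N := r)) => h h' e; exact: alive_local.
  - by apply: mem_set; exact: measurable_rounds_span.
  move=> w /= /terminated_bounds[nr ns]; split; last first.
    by apply: le_trans ns _; rewrite lee_fin.
  apply: le_trans nr _; rewrite lee_fin; apply: le_trans rC.
  by rewrite ler_peMl.
have [n2|] := leqP 2 #|V|; last first.
  (* For [n = 1] the claimed probability is 0. For [n = 0] the logarithm and the power are 0 by
     convention, and no process is alive at round 0. *)
  rewrite ltnS leq_eqVlt ltnS leqn0 => /orP[]/eqP nE.
    by rewrite /n nE powR1 subrr; exact: measure_ge0.
  have -> : (n `^ (- c) = n * (7 / 8) ^+ 0)%R.
    by rewrite /n nE powR0 ?mul0r // oppr_eq0 gt_eqF.
  by apply: sub; rewrite mulr0 /n nE ln0 ?mulr0.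
have n2' : (2 <= n)%R by rewrite ler_nat.
have n0 : (0 < n)%R by lra.
have ln2 : (1 / 2 <= ln n)%R.
  apply: le_trans (_ : ln 2 <= _)%R; last by rewrite ler_ln ?posrE //; lra.
  have := @ln_ge_ratio R 1 ler01; rewrite (_ : 1 + 1 = 2)%R; lra.
have cl : (0 <= (c + 1) * ln n)%R by apply: mulr_ge0; lra.
(* This time makes the failure bound [n * expR (- ((c + 1) * ln n))], the required power of [n]. The
   extra round from rounding up is absorbed by [2 * ln n], since [ln n] is at least 1/2. *)
apply: le_trans (sub (decay_time ((c + 1) * ln n)) _).
  rewrite lee_fin lerD2l lerN2; apply: le_trans (_ : n * expR (- ((c + 1) * ln n)) <= _)%R.
    by rewrite ler_wpM2l ?decay_timeP //; lra.
  have nE : n = expR (ln n) by rewrite lnK ?posrE.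
  rewrite /powR gt_eqF // {1}nE -expRD ler_expR le_eqVlt; apply/orP; left.
  by apply/eqP; ring.
rewrite -mulrA ler_wpM2l //.
apply: le_trans (decay_time_le cl) _; rewrite /C.
have -> : (((c + 1) / decay_rate R + 2) * ln n = (c + 1) * ln n / decay_rate R + 2 * ln n)%R.
  by ring.
by rewrite lerD2l; lra.
Qed.

End OneInput.

Section TwoInputs.
Variables (k : nat) (E E' : {set {set V}}) (A A' : slots).
Hypotheses (EF : bounded_forest t E) (EF' : bounded_forest t E').
Hypotheses (EA : encodes E A) (EA' : encodes E' A').
Hypotheses (EE' : modified k E E') (AA' : same_slots E E' A A').
Let mu : R := (56 * (2 * (2 * t).+1))%:R.
Let kR : R := k%:R.

Lemma expected_round_distance i :
  let e := \int[P]_w (round_distance E E' A A' i (coins_at Heads w))%:R%:E in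
  e <= (K * mu * kR)%:E /\ e <= (2 * K * n * (7 / 8) ^+ i)%:E.
Proof.
have Dloc := @round_distance_local t disp V E E' A A' i.
split.
- have -> : (K * mu * kR = (56 * (3 * t + 8) * (2 * (2 * t).+1) * k)%N%:R / 1%N%:R :> R)%R.
    by rewrite divr1 /K /mu /kR !natrM; ring.
  apply: (expectation_local_le fair Dloc) => //; rewrite mul1n.
  exact: (sum_round_distance_marked EF EF' EA EA' EE' AA' (leqnSn i)).
have -> : (2 * K * n * (7 / 8) ^+ i = (2 * (3 * t + 8) * 7 ^ i * #|V|)%N%:R / (8 ^ i)%N%:R :> R)%R.
  by rewrite pow_ratio natrM.
apply: (expectation_local_le fair Dloc); first by rewrite expn_gt0.
exact: (sum_round_distance_alive EF EF' EA EA' AA' (leqnSn i)).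
Qed.

Lemma expected_distance_le (r : nat) :
  \int[P]_w computation_distance R (MR t (coins_at Heads w)) (MR_input E A) (MR_input E' A')
  <= (K * mu * kR * r%:R + 16 * K * n * (7 / 8) ^+ r)%:E.
Proof.
have Dloc := @round_distance_local t disp V E E' A A'.
(* Each expectation is a finite average, so [fine] loses nothing. *)
pose g i : R := fine (\int[P]_w (round_distance E E' A A' i (coins_at Heads w))%:R%:E).
have gE i : \int[P]_w (round_distance E E' A A' i (coins_at Heads w))%:R%:E = (g i)%:E.
  by rewrite /g (expectation_local fair (Dloc i)).
apply: (expected_series_le (F := round_distance E E' A A') (g := g)) => // [i|m].
  by rewrite gE.
have -> : (16 * K * n = 8 * (2 * K * n))%R by ring.
by apply: capped_geometric_sum; rewrite ?mulr_ge0 // => i; rewrite -lee_fin -gE;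
  have [] := expected_round_distance i.
Qed.

Lemma expected_distance :
  \int[P]_w computation_distance R (MR t (coins_at Heads w)) (MR_input E A) (MR_input E' A')
  <= (K * (mu / decay_rate R + 2 * mu + 32) * (kR * ln (1 + n / kR)))%:E.
Proof.
have K0 : (0 <= K)%R by [].
have mu0 : (0 <= mu)%R by [].
have n0 : (0 <= n)%R by [].
have l0 := decay_rate_gt0 R.
(* For [k = 0] the right side vanishes by its factor [k], and so does the bound on each round. *)
have [k0|kpos] := posnP k.
  have kR0 : kR = 0%R by rewrite /kR k0.
  rewrite kR0 mul0r mulr0.
  apply: (expected_series_le (F := round_distance E E' A A') (g := fun=> 0%R)) => [i|i|m].
  - exact: round_distance_local.
  - by have [+ _] := expected_round_distance i; rewrite kR0 mulr0.
  - by rewrite big1.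
have k0 : (0 < kR)%R by rewrite ltr0n.
pose x := (n / kR)%R.
have nE : n = (kR * x)%R by rewrite /x mulrCA divff ?mulr1 // gt_eqF.
have x0 : (0 <= x)%R by rewrite divr_ge0 // ltW.
have x1 : (0 < 1 + x)%R by lra.
rewrite -/x; set L := ln _; have Lge := ln_ge_ratio x0; rewrite -/L in Lge.
have L0 : (0 <= L)%R by apply: le_trans Lge; rewrite divr_ge0 // ltW.
pose l := (mu / decay_rate R)%R.
have muL : (0 <= l)%R by rewrite divr_ge0 // ltW.
have Kk : (0 <= K * kR)%R by rewrite mulr_ge0 // ltW.
have -> : (K * (mu / decay_rate R + 2 * mu + 32) * (kR * L)
           = K * kR * ((l + 2 * mu + 32) * L))%R by rewrite /l; ring.
have lL : (0 <= l * L)%R by rewrite mulr_ge0.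
(* For [n <= k] the geometric bound is used from round 0 on; it gives [16 * x], and [x <= 2 * L]
   accounts for the 32. *)
have [xle|xgt] := leP x 1%R.
  apply: le_trans (expected_distance_le 0) _; rewrite lee_fin mulr0 add0r expr0 mulr1.
  have xL : (x <= 2 * L)%R.
    suff : (x / 2 <= x / (1 + x))%R by lra.
    by rewrite ler_wpM2l // lef_pV2 ?posrE //; lra.
  have -> : (16 * K * n = K * kR * (16 * x))%R by rewrite nE; ring.
  rewrite ler_wpM2l //; have muLL : (0 <= mu * L)%R by rewrite mulr_ge0.
  lra.
(* From this round on, the geometric part costs at most [16 * (x / (1 + x))]. This and the extra
   round from rounding are constants, absorbed by [32] and [2 * mu] because [L] is at least 1/2. *)
apply: le_trans (expected_distance_le (decay_time L)) _; rewrite lee_fin.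
have L2 : (1 / 2 <= L)%R.
  by apply: le_trans Lge; rewrite ler_pdivlMr //; lra.
have := decay_time_le L0; have := decay_timeP L0; move: (decay_time L) => r.
rewrite expRN lnK ?posrE // => qr rL.
have tail : (x * (7 / 8) ^+ r <= 1)%R.
  by apply: le_trans (ler_wpM2l x0 qr) _; rewrite ler_pdivrMr // mul1r lerDr.
have -> : (K * mu * kR * r%:R + 16 * K * n * (7 / 8) ^+ r
   = K * kR * (mu * r%:R + 16 * (x * (7 / 8) ^+ r)))%R by rewrite nE; ring.
rewrite ler_wpM2l //; move: ((7 / 8) ^+ r)%R tail {qr} => q tail.
have : (mu * r%:R <= l * L + mu)%R.
  have -> : (l * L + mu = mu * (L / decay_rate R + 1))%R by rewrite /l; ring.
  by rewrite ler_wpM2l.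
have : (mu * (1 / 2) <= mu * L)%R by rewrite ler_wpM2l.
lra.
Qed.

End TwoInputs.
End MainBounds.
Theorem theorem1p3 (R : realType) (t : nat) :
  (exists C : R,
    forall (disp : Order.disp_t) (V : finOrderType disp)
      (E : {set {set V}}) (A : V -> 'I_t -> slot t V)
      (d : measure_display) (Omega : measurableType d)
      (P : probability Omega R) (Heads : nat * V -> {RV P >-> bool}),
    bounded_forest t E -> encodes E A -> fair_coins Heads ->
    (\int[P]_w total_work R (MR t (fun i v => Heads (i, v) w)) (MR_input E A)
       <= (C * #|V|%:R)%:E)%E)
  /\
  (forall c : R, (0 < c)%R -> exists C : R,
    forall (disp : Order.disp_t) (V : finOrderType disp)
      (E : {set {set V}}) (A : V -> 'I_t -> slot t V)
      (d : measure_display) (Omega : measurableType d)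
      (P : probability Omega R) (Heads : nat * V -> {RV P >-> bool}),
    bounded_forest t E -> encodes E A -> fair_coins Heads ->
    ((1 - #|V|%:R `^ (- c))%:E <=
       P [set w |
            num_rounds R (MR t (fun i v => Heads (i, v) w)) (MR_input E A)
              <= (C * ln #|V|%:R)%:E
          /\ total_span R (MR t (fun i v => Heads (i, v) w)) (MR_input E A)
              <= (C * ln #|V|%:R)%:E]%classic)%E)
  /\
  (exists C : R,
    forall (disp : Order.disp_t) (V : finOrderType disp) (k : nat)
      (E E' : {set {set V}}) (A A' : V -> 'I_t -> slot t V)
      (d : measure_display) (Omega : measurableType d)
      (P : probability Omega R) (Heads : nat * V -> {RV P >-> bool}),
    bounded_forest t E -> bounded_forest t E' -> modified k E E' ->
    encodes E A -> encodes E' A' -> same_slots E E' A A' ->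
    fair_coins Heads ->
    (\int[P]_w computation_distance R (MR t (fun i v => Heads (i, v) w))
                 (MR_input E A) (MR_input E' A')
       <= (C * (k%:R * ln (1 + #|V|%:R / k%:R)))%:E)%E).
Proof.
split; [|split].
- exists (8 * (3 * t + 8)%:R)%R => disp V E A d Omega P Heads EF EA fair.
  exact: expected_total_work.
- move=> c c0; exists ((3 * t + 8)%:R * ((c + 1) / decay_rate R + 2))%R.
  move=> disp V E A d Omega P Heads EF EA fair.
  exact: logarithmic_rounds_span.
- exists ((3 * t + 8)%:R * ((56 * (2 * (2 * t).+1))%:R / decay_rate R
          + 2 * (56 * (2 * (2 * t).+1))%:R + 32))%R.
  move=> disp V k E E' A A' d Omega P Heads EF EF' EE' EA EA' AA' fair.
  exact: (expected_distance fair EF EF' EA EA' EE' AA').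
Qed.
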